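(* Let $k\ge2$ be an integer and let $P\in\mathbb{R}_+[X_1,\dots,X_n]$ be an elliptic polynomial of degree $d\ge1$ with homogeneous part of highest degree $P_d$. For $t>0$ set $$N(\mathbf 1_{B_k};P;t)=\#\{\mathbf m\in\mathbb{N}^n:\ P^{1/d}(m_1,\dots,m_n)\le t\ \text{ and } m_i \text{ is } k\text{-free for all } i\}.$$ Then there exists $\theta>0$ such that $N(\mathbf 1_{B_k};P;t)=C_n(B_k,P)\,t^n+O(t^{n-\theta})$ as $t\to\infty$, where $$C_n(B_k,P)=\Big(\frac1{\zeta(k)}\Big)^n\cdot\frac1n\int_{\mathbb{S}^{n-1}\cap\mathbb{R}_+^n}P_d^{-n/d}(\mathbf v)\,d\sigma(\mathbf v).$$
   Context: $\mathbb{N}=\{1,2,\dots\}$, $\mathbb{R}_+=[0,\infty)$. A polynomial $P\in\mathbb{R}[X_1,\dots,X_n]$ of degree $d$ is elliptic if its homogeneous part $P_d$ of highest degree satisfies $P_d(\mathbf x)>0$ for all $\mathbf x\in\mathbb{R}_+^n\setminus\{\mathbf 0\}$. An integer $m\in\mathbb{N}$ is $k$-free if $v_p(m)\le k-1$ for every prime $p$. $\mathbb{S}^{n-1}$ is the Euclidean unit sphere of $\mathbb{R}^n$ and $d\sigma$ is the induced Lebesgue (surface) measure; $\zeta$ is the Riemann zeta function. $B_k\subset\mathbb{N}^n$ is the set of $\mathbf m$ all of whose coordinates are $k$-free. *)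

(* Defs.v *)
From HB Require Import structures.
From mathcomp Require Import all_boot all_order all_algebra.
From mathcomp Require Import finmap.
(* The notations of mpoly clash with those of mathcomp-analysis. *)
From mathcomp.multinomials Require Import(canonicals, coercions) mpoly.
From mathcomp Require Import all_classical all_reals all_analysis.
From mathcomp Require Import measurable_realfun.

Set Implicit Arguments.
Unset Strict Implicit.
Unset Printing Implicit Defensive.

Import Order.TTheory GRing.Theory Num.Theory.
Import numFieldNormedType.Exports.

Local Open Scope classical_set_scope.
Local Open Scope ring_scope.

Definition kfree (k m : nat) : Prop :=
  (0 < m)%N /\ forall p : nat, prime p -> (logn p m <= k.-1)%N.

(* riemannR s j = 1 / (j + 1) ^ s; meaningful for s > 1 only. *)
Definition zeta {R : realType} (s : R) : R := limn (series (riemannR s)).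

Definition orthant {R : realType} {n : nat} : set (n.-tuple R) :=
  [set x | forall i, 0 <= tnth x i].

Section polynomials.
Context {R : realType} {n : nat}.
Implicit Types (P : mpoly.mpoly n R) (x : n.-tuple R).

Definition peval P x : R := mpoly.meval (tnth x) P.

(* mpoly.msize is one plus the total degree, and 0 for the zero polynomial. *)
Definition has_degree (d : nat) P : Prop := mpoly.msize P = d.+1.

Definition top_part P : mpoly.mpoly n R :=
  mpoly.pihomog mpoly.mdeg (mpoly.msize P).-1 P.

Definition nonneg_coeffs P : Prop :=
  forall a : mpoly.multinom n, 0 <= mpoly.mcoeff a P.

Definition elliptic P : Prop :=
  forall x, orthant x -> x <> [tuple of nseq n 0] -> 0 < peval (top_part P) x.

(* The set counted is finite for elliptic P with nonnegative coefficients and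
   of degree d >= 1; fset_set sends infinite sets to fset0. *)
Definition count_kfree (k d : nat) P (t : R) : nat :=
  #|` fset_set [set m : n.-tuple nat |
       peval P [tuple of [seq j%:R | j <- m]] `^ d%:R^-1 <= t /\
       forall i, kfree k (tnth m i)]|.

End polynomials.

Section lebesgue_tuple.
Context {R : realType}.

Definition pcons n (z : R * n.-tuple R) : n.+1.-tuple R := [tuple of z.1 :: z.2].

Lemma measurable_pcons n : measurable_fun [set: R * n.-tuple R] (@pcons n).
Proof. exact: (measurable_cons (f := fst) (g := snd)). Qed.

(* n-dimensional Lebesgue measure on the Borel sets of R^n, as an iterated
   product; R^0 is a single point of mass 1. *)
Fixpoint lebesgue_tuple (n : nat) : set (n.-tuple R) -> \bar R :=
  match n with
  | 0 => \d_([tuple] : 0.-tuple R)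
  | n'.+1 => pushforward (lebesgue_measure \x^ @lebesgue_tuple n')%E (@pcons n')
  end.
Arguments lebesgue_tuple n _ : clear implicits.

Lemma lebesgue_tuple_measure n :
  exists mu : {measure set (n.-tuple R) -> \bar R},
    lebesgue_tuple n = mu :> (set _ -> _).
Proof.
elim: n => [|n [mu muE]] /=.
  by exists (\d_([tuple] : 0.-tuple R)).
rewrite muE.
exact: (ex_intro _
  (measure_function_pushforward__canonical__measure_function_Measure
    (lebesgue_measure \x^ mu)%E (@measurable_pcons n)) erefl).
Qed.

Section measure.
Variable n : nat.

Let lebesgue_tuple0 : lebesgue_tuple n set0 = 0%E.
Proof. by have [mu ->] := lebesgue_tuple_measure n; exact: measure0. Qed.

Let lebesgue_tuple_ge0 A : (0 <= lebesgue_tuple n A)%E.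
Proof. by have [mu ->] := lebesgue_tuple_measure n; exact: measure_ge0. Qed.

Let lebesgue_tuple_sigma_additive : semi_sigma_additive (lebesgue_tuple n).
Proof.
by have [mu ->] := lebesgue_tuple_measure n; exact: measure_semi_sigma_additive.
Qed.

HB.instance Definition _ := isMeasure.Build _ _ _ (lebesgue_tuple n)
  lebesgue_tuple0 lebesgue_tuple_ge0 lebesgue_tuple_sigma_additive.

End measure.
End lebesgue_tuple.
Arguments lebesgue_tuple {R} n _.

Section sphere.
Context {R : realType} {n : nat}.
Implicit Types x : n.-tuple R.

Definition enorm x : R := Num.sqrt (\sum_(i < n) tnth x i ^+ 2).

Definition sphere : set (n.-tuple R) := [set x | enorm x = 1].

Definition udir x : n.-tuple R := [tuple (enorm x)^-1 * tnth x i | i < n].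

Lemma measurable_enorm : measurable_fun setT enorm.
Proof.
rewrite (_ : enorm = (fun y : R => y `^ 2^-1) \o
    (fun x => \sum_(i < n) tnth x i ^+ 2)); last first.
  by apply/funext => x /=; rewrite powR12_sqrt// sumr_ge0// => i _; rewrite sqr_ge0.
apply: measurableT_comp; first exact: measurable_powR.
by apply: measurable_sum => i; apply: measurable_funX; exact: measurable_tnth.
Qed.

Lemma measurable_udir : measurable_fun setT udir.
Proof.
apply/measurable_fun_tnthP => i.
rewrite (_ : _ \o _ = fun x => enorm x `^ (- 1) * tnth x i); last first.
  by apply/funext => x /=; rewrite tnth_mktuple powR_inv1// sqrtr_ge0.
apply: measurable_funM; last exact: measurable_tnth.
apply: (measurableT_comp (f := fun y : R => y `^ (- 1)) (g := enorm)).
  exact: measurable_powR.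
exact: measurable_enorm.
Qed.

Definition punctured_ball : set (n.-tuple R) := [set x | 0 < enorm x <= 1].

Lemma measurable_punctured_ball : measurable punctured_ball.
Proof.
rewrite (_ : punctured_ball = enorm @^-1` `]0, 1]%classic); last first.
  by apply/seteqP; split => x /=; rewrite in_itv.
by rewrite -[X in measurable X]setTI; exact: measurable_enorm.
Qed.

(* The surface measure of the unit sphere is the one for which
   dx = r ^ (n - 1) dr dsigma(v) at x = r v; equivalently, a Borel set A of
   directions has measure n times the volume of the solid cone
   {r v | v in A, 0 < r <= 1}. It is carried by the sphere. *)
Definition surface_measure (A : set (n.-tuple R)) : \bar R :=
  (n%:R%:E * lebesgue_tuple n (punctured_ball `&` udir @^-1` A))%E.

Lemma surface_measure_measure :
  exists mu : {measure set (n.-tuple R) -> \bar R},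
    surface_measure = mu :> (set _ -> _).
Proof.
pose r : {nonneg R} := NngNum (ler0n R n).
pose restr : {measure set (n.-tuple R) -> \bar R} :=
  mrestr (lebesgue_tuple n) measurable_punctured_ball.
pose push := measure_function_pushforward__canonical__measure_function_Measure
  restr measurable_udir.
by exists (mscale r push); apply/funext => A; rewrite /surface_measure setIC.
Qed.

Let surface_measure0 : surface_measure set0 = 0%E.
Proof. by have [mu ->] := surface_measure_measure; exact: measure0. Qed.

Let surface_measure_ge0 A : (0 <= surface_measure A)%E.
Proof. by have [mu ->] := surface_measure_measure; exact: measure_ge0. Qed.

Let surface_measure_sigma_additive : semi_sigma_additive surface_measure.
Proof.
have [mu ->] := surface_measure_measure; exact: measure_semi_sigma_additive.
Qed.

HB.instance Definition _ := isMeasure.Build _ _ _ surface_measure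
  surface_measure0 surface_measure_ge0 surface_measure_sigma_additive.

End sphere.

Definition leading_constant {R : realType} {n : nat} (k d : nat)
    (P : mpoly.mpoly n R) : R :=
  (zeta (k%:R : R))^-1 ^+ n * (n%:R^-1 *
    \int[surface_measure]_(v in sphere `&` orthant)
      (peval (top_part P) v `^ (- (n%:R / d%:R)))).

(* Main.v *)
Require Import Defs.
From mathcomp Require Import all_boot all_order all_algebra.
From mathcomp Require Import finmap.
From mathcomp.multinomials Require Import(canonicals, coercions) mpoly.
From mathcomp Require Import all_classical all_reals all_analysis.
From mathcomp Require Import measurable_realfun.
From mathcomp Require Import ring lra.
Import Order.TTheory GRing.Theory Num.Theory.
Import numFieldNormedType.Exports.
Local Open Scope classical_set_scope.
Local Open Scope ring_scope.

Set Implicit Arguments.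
Unset Strict Implicit.
Unset Printing Implicit Defensive.

(** The k-free integers have density c = 1 / zeta(k) with a power-saving error
    term.  Every positive integer is uniquely a b^k with a k-free, so the
    number Q(x) of k-free integers up to x satisfies
    floor(x) = sum over b >= 1 of Q(x / b^k), and E(x) = Q(x) - c x satisfies
    |E(x)| <= 2 + sum over b >= 2 of |E(x / b^k)|.  The bound E(x) = O(x^s)
    propagates through this inequality by induction on floor(x) as soon as the sum
    of b^(-k s) over b >= 2 is less than 1; this holds for some s < 1 because
    zeta(2) < 2 ([kfree_count_estimate]; s is [saving]).

    In dimension n, let D be a measurable down-set in [0, L]^n.  Each line
    parallel to an axis meets D in an initial segment of length at most L, on
    which counting k-free integers and c times Lebesgue measure differ by
    O(L^s).  Exchanging the two measures one coordinate at a time gives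
    #(D, k-free) = c^n vol(D) + O(L^(n - 1 + s)) ([grid_count_estimate]).

    As P has nonnegative coefficients, so has its leading form Q = P_d, and the
    sublevel sets D_r = {x >= 0, Q(x) < r^d} are down-sets.  Ellipticity gives
    Q(e_i) > 0, hence D_r lies in [0, L r]^n for a constant L, and homogeneity
    gives vol(D_r) = r^n vol(D_1).  On the relevant box P - Q = O(t^(d - 1)),
    so for some constant K the points with P <= t^d lie between D_(t - K) and
    D_(t + 1), whose volumes differ from vol(D_1) t^n by O(t^(n - 1))
    ([count_kfree_estimate]).

    Finally vol(D_1) is the integral in the leading constant: D_1 is, up to the
    origin, the set where |x|^n < Q(x / |x|)^(-n / d), and integration in polar
    coordinates computes the volume of such a star-shaped set
    ([surface_integral_star_region], [leading_constant_volume]). *)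

(** * The density of the k-free integers *)

Definition kfree_upto (k N : nat) : seq nat := [seq m <- iota 1 N | `[< kfree k m >]].

Definition kfree_count (k N : nat) : nat := size (kfree_upto k N).

Lemma kfree_countS k N :
  kfree_count k N.+1 = (kfree_count k N + `[< kfree k N.+1 >])%N.
Proof.
rewrite /kfree_count /kfree_upto.
have -> : iota 1 N.+1 = iota 1 N ++ [:: N.+1] by rewrite -[N.+1]addn1 iotaD add1n addn1.
by rewrite filter_cat size_cat /=; case: asboolP.
Qed.

(** Take for b the largest integer with b ^ k dividing m: if p ^ k divided the
    cofactor, then p b would be a larger choice. *)
Lemma kfree_exp_decomposition k m : (0 < k)%N -> (0 < m)%N ->
  exists b a, [/\ (0 < b)%N, kfree k a & m = (a * b ^ k)%N].
Proof.
move=> k0 m0.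
have ex1 : exists b, (0 < b)%N && (b ^ k %| m)%N by exists 1%N; rewrite exp1n dvd1n.
have ub b : (0 < b)%N && (b ^ k %| m)%N -> (b <= m)%N.
  move=> /andP[b0 /dvdn_leq] /(_ m0); apply: leq_trans.
  by rewrite -[X in (X <= _)%N]expn1 leq_pexp2l.
case: (ex_maxnP ex1 ub) => b /andP[b0 /dvdnP[a mE]] bmax.
exists b, a; split => //; split.
  by move: m0; rewrite mE muln_gt0 => /andP[].
move=> p pp; rewrite leqNgt; apply/negP => kp.
have a0 : (0 < a)%N by move: m0; rewrite mE muln_gt0 => /andP[].
have pa : (p ^ k %| a)%N by rewrite pfactor_dvdn// -(prednK k0).
have := bmax (p * b)%N; rewrite muln_gt0 prime_gt0// b0 expnMn mE dvdn_mul//.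
by move=> /(_ isT); rewrite leqNgt ltn_Pmull// prime_gt1.
Qed.

(** The p-adic valuation of b is the quotient by k of that of a b ^ k, since
    that of a is less than k. *)
Lemma kfree_exp_unique k a b a' b' : (0 < k)%N -> (0 < b)%N -> (0 < b')%N ->
  kfree k a -> kfree k a' -> (a * b ^ k = a' * b' ^ k)%N -> b = b'.
Proof.
move=> k0 b0 b'0 [a0 ka] [a'0 ka'] e; apply: eqn_from_log => // p.
case: (boolP (prime p)) => pp; last by rewrite lognE [RHS]lognE (negbTE pp).
have val c d : (0 < c)%N -> (0 < d)%N -> (logn p c <= k.-1)%N ->
    (logn p (c * d ^ k) %/ k)%N = logn p d.
  move=> c0 d0 kc; rewrite lognM ?expn_gt0 ?d0// lognX addnC mulnC divnMDl//.
  by rewrite divn_small ?addn0 // -(prednK k0) ltnS.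
by rewrite -(val a)// ?ka// e val// ka'.
Qed.

(** This relation replaces Moebius inversion.  By induction on N: going from N
    to N + 1 changes the term of index b exactly when N + 1 is b ^ k times a
    k-free integer, and there is just one such b. *)
Lemma sum_kfree_count k N B : (0 < k)%N -> (N <= B)%N ->
  (\sum_(1 <= b < B.+1) kfree_count k (N %/ b ^ k))%N = N.
Proof.
move=> k0; elim: N => [_|N IH NB].
  by rewrite big1// => b _; rewrite div0n.
have [b0 [a0 [b00 ka0 NE]]] := @kfree_exp_decomposition k N.+1 k0 isT.
have b0N : (b0 <= N.+1)%N.
  rewrite NE; apply: (@leq_trans (b0 ^ k)%N).
    by rewrite -[X in (X <= _)%N]expn1 leq_pexp2l.
  by rewrite leq_pmull//; case: ka0.
rewrite (eq_big_nat _ _ (F2 := fun b =>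
  kfree_count k (N %/ b ^ k) + (b == b0))%N); last first.
  move=> b /andP[b1 bB].
  have bk : (0 < b ^ k)%N by rewrite expn_gt0 b1.
  rewrite divnS//.
  case: (boolP (b ^ k %| N.+1)%N) => [bN|bN] /=; last first.
    rewrite add0n; case: eqP => [bb|]; last by rewrite addn0.
    by move: bN; rewrite bb {1}NE dvdn_mull.
  rewrite add1n kfree_countS; congr (_ + nat_of_bool _)%N.
  have qE : ((N %/ b ^ k).+1 * b ^ k = N.+1)%N.
    by have := divnK bN; rewrite divnS// bN add1n.
  apply/asboolP/eqP => [ka|bb].
    by apply: (kfree_exp_unique k0 b1 b00 ka ka0); rewrite qE.
  rewrite bb in qE bk *.
  by move: qE; rewrite NE => /eqP; rewrite eqn_pmul2r// => /eqP ->.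
rewrite big_split /= IH ?(ltnW NB)// -[RHS]addn1; congr addn.
rewrite (bigD1_seq b0) /= ?mem_index_iota ?b00 ?ltnS ?(leq_trans b0N)//; last exact: iota_uniq.
by rewrite eqxx big1 ?addn0// => i /negbTE ->.
Qed.

Section series_bounds.
Context {R : realType}.

(** Telescoping from b = 3 on, with 1 / b ^ 2 <= 1 / (b - 1) - 1 / b; the term
    b = 2 is kept exactly, so that the bound is less than 1. *)
Lemma sum_inv_sqr_le (B : nat) : \sum_(2 <= b < B.+1) (b%:R ^+ 2)^-1 <= 3 / 4 :> R.
Proof.
have [B2|B2] := leqP B 1.
  by rewrite big_geq//; lra.
have {B2} : exists i, B = i.+2 by exists B.-2; case: B B2 => [|[]].
move=> [i ->].
suff : \sum_(2 <= b < i.+3) (b%:R ^+ 2)^-1 <= 3 / 4 - i.+2%:R^-1 :> R.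
  by move=> /le_trans; apply; rewrite lerBlDr lerDl invr_ge0.
elim: i => [|i IH]; first by rewrite big_nat1; lra.
rewrite big_nat_recr//=; apply: (le_trans (lerD IH (lexx _))).
set x : R := i.+2%:R.
have -> : i.+3%:R = x + 1 :> R by rewrite -natr1.
have x0 : 0 < x by rewrite ltr0n.
suff : ((x + 1) ^+ 2)^-1 <= x^-1 - (x + 1)^-1.
  by move: (x ^-1) (x + 1)^-1 ((x + 1) ^- 2) => p q r; lra.
have -> : x^-1 - (x + 1)^-1 = (x * (x + 1))^-1.
  by field; rewrite !gt_eqF//; lra.
have x1 : 0 < x + 1 by lra.
by rewrite lef_pV2 ?posrE ?exprn_gt0 ?mulr_gt0// expr2 ler_pM2r//; lra.
Qed.

(** Telescoping, with b ^ (- 3 / 2) <= 2 / sqrt (b - 1) - 2 / sqrt b. *)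
Lemma sum_inv_3half_le (B : nat) :
  \sum_(2 <= b < B.+1) (b%:R * Num.sqrt b%:R)^-1 <= 2 :> R.
Proof.
case: B => [|B]; first by rewrite big_geq.
suff : \sum_(2 <= b < B.+2) (b%:R * Num.sqrt b%:R)^-1 <= 2 - 2 / Num.sqrt B.+1%:R :> R.
  by move=> /le_trans; apply; rewrite lerBlDr lerDl divr_ge0// sqrtr_ge0.
elim: B => [|B IH]; first by rewrite big_geq// sqrtr1; lra.
rewrite big_nat_recr//=; apply: (le_trans (lerD IH (lexx _))).
set u : R := Num.sqrt _; set v : R := Num.sqrt B.+2%:R.
have u0 : 0 < u by rewrite sqrtr_gt0 ltr0n.
have v0 : 0 < v by rewrite sqrtr_gt0 ltr0n.
have u2 : u ^+ 2 = B.+1%:R by rewrite sqr_sqrtr.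
have v2 : B.+2%:R = v ^+ 2 by rewrite sqr_sqrtr.
have uv1 : v ^+ 2 = u ^+ 2 + 1 by rewrite -v2 u2 natr1.
rewrite v2.
suff : (v ^+ 2 * v)^-1 <= 2 / u - 2 / v.
  by move: (2 / u) (2 / v) ((v ^+ 2 * v)^-1) => p q r; lra.
have uv : u <= v by rewrite ler_sqrt// ler_nat.
have -> : 2 / u - 2 / v = (u * v * (u + v) / 2)^-1.
  have : 1 = (v - u) * (v + u) by rewrite -subr_sqr uv1; ring.
  move=> e.
  have -> : 2 / u - 2 / v = 2 * ((v - u) * (v + u)) / (u * v * (u + v)).
    by field; rewrite !gt_eqF//; lra.
  by rewrite -e; field; rewrite !gt_eqF//; lra.
by rewrite lef_pV2 ?posrE ?mulr_gt0 ?invr_gt0 ?addr_gt0 ?exprn_gt0//; nra.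
Qed.

(** The exponent of the error term.  Any s < 1 for which the b ^ (- 2 s),
    b >= 2, sum to less than 1 would do; this one is an integer over a power of
    2, which makes the bound of the sum elementary. *)
Definition saving : R := 31 / 32.

(** With b = y ^ 16 the left-hand side is y / b ^ 2, and three applications of
    z <= (1 + z ^ 2) / 2 give y <= 7 / 8 + y ^ 8 / 8. *)
Lemma saving_weight_le (b : nat) : (0 < b)%N ->
  ((b%:R ^+ 2)^-1) `^ saving <=
    7 / 8 * (b%:R ^+ 2)^-1 + 1 / 8 * (b%:R * Num.sqrt b%:R)^-1 :> R.
Proof.
move=> b0.
have [y y0 yb] : exists2 y : R, 0 < y & b%:R = y ^+ 16.
  exists (b%:R `^ 16^-1); first by rewrite powR_gt0// ltr0n.
  by rewrite -powR_mulrn ?powR_ge0// -powRrM mulVf ?powRr1// ler0n.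
have -> : Num.sqrt b%:R = y ^+ 8.
  by rewrite yb -[16%N]/(8 * 2)%N exprM sqrtr_sqr ger0_norm// exprn_ge0// ltW.
have -> : (b%:R ^+ 2)^-1 `^ saving = y * (y ^+ 32)^-1.
  have e : (y ^+ 32)^-1 = y `^ (- 32) by rewrite powRN -powR_mulrn ?(ltW y0).
  rewrite yb -exprM -[(16 * 2)%N]/32%N e -powRrM -{2}(powRr1 (ltW y0)) -powRD.
    by congr (_ `^ _); rewrite /saving; lra.
  by rewrite (gt_eqF y0) implybT.
rewrite yb.
have -> : (y ^+ 16 * y ^+ 8)^-1 = y ^+ 8 * (y ^+ 32)^-1.
  by field; rewrite gt_eqF.
rewrite -exprM -[(16 * 2)%N]/32%N mulrA -mulrDl ler_pM2r ?invr_gt0 ?exprn_gt0//.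
have : 0 <= (y - 1) ^+ 2 by exact: sqr_ge0.
have : 0 <= (y ^+ 2 - 1) ^+ 2 by exact: sqr_ge0.
have : 0 <= (y ^+ 4 - 1) ^+ 2 by exact: sqr_ge0.
have -> : y ^+ 8 = (y ^+ 4) ^+ 2 by rewrite -exprM.
have -> : y ^+ 4 = (y ^+ 2) ^+ 2 by rewrite -exprM.
by nra.
Qed.

(** The contraction factor: 7 / 8 * 3 / 4 + 1 / 8 * 2 = 29 / 32 is less than 1. *)
Lemma sum_saving_weight_le (k B : nat) : (2 <= k)%N ->
  \sum_(2 <= b < B.+1) ((b%:R ^+ k)^-1) `^ saving <= 29 / 32 :> R.
Proof.
move=> k2; apply: (@le_trans _ _ (\sum_(2 <= b < B.+1)
    (7 / 8 * (b%:R ^+ 2)^-1 + 1 / 8 * (b%:R * Num.sqrt b%:R)^-1))).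
  rewrite big_nat [leRHS]big_nat; apply: ler_sum => b /andP[b2 _].
  apply: le_trans (saving_weight_le (ltnW b2)).
  have b1 : 1 <= b%:R :> R by rewrite ler1n ltnW.
  apply: ge0_ler_powR; rewrite ?nnegrE ?invr_ge0 ?exprn_ge0//.
    by rewrite /saving; lra.
  rewrite lef_pV2 ?posrE ?exprn_gt0// ?(lt_le_trans _ b1)//.
  exact: ler_weXn2l.
rewrite big_split /= -!mulr_sumr.
by have := sum_inv_sqr_le B; have := sum_inv_3half_le B; lra.
Qed.

Lemma series_riemannRE (k B : nat) :
  series (riemannR (k%:R : R)) B = \sum_(1 <= b < B.+1) (b%:R ^+ k)^-1.
Proof.
by rewrite seriesEnat big_add1 /=; apply: eq_bigr => b _; rewrite /riemannR powR_mulrn.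
Qed.

Lemma series_riemannR_le (k B : nat) : (2 <= k)%N ->
  series (riemannR (k%:R : R)) B <= 7 / 4.
Proof.
move=> k2; rewrite series_riemannRE.
case: B => [|B]; first by rewrite big_geq//; lra.
rewrite big_ltn// expr1n invr1.
suff : \sum_(2 <= i < B.+2) ((i%:R : R) ^+ k)^-1 <= 3 / 4 by lra.
apply: le_trans (sum_inv_sqr_le B.+1).
rewrite big_nat [leRHS]big_nat; apply: ler_sum => b /andP[b2 _].
have b1 : 1 <= b%:R :> R by rewrite ler1n ltnW.
rewrite lef_pV2 ?posrE ?exprn_gt0// ?(lt_le_trans _ b1)//.
exact: ler_weXn2l.
Qed.

Lemma nondecreasing_series_riemannR (k : nat) :
  nondecreasing_seq (series (riemannR (k%:R : R))).
Proof. by apply: nondecreasing_series => i _ _; exact/ltW/riemannR_gt0. Qed.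

Lemma cvg_series_riemannR (k : nat) : (2 <= k)%N ->
  series (riemannR (k%:R : R)) @ \oo --> zeta (k%:R : R).
Proof.
move=> k2; apply: nondecreasing_is_cvgn.
  exact: nondecreasing_series_riemannR.
by exists (7 / 4) => _ [B _ <-]; exact: series_riemannR_le.
Qed.

Lemma zeta_ge1 (k : nat) : (2 <= k)%N -> 1 <= zeta (k%:R : R).
Proof.
move=> k2.
have := nondecreasing_cvgn_le (@nondecreasing_series_riemannR k)
  (cvgP _ (cvg_series_riemannR k2)) 1%N.
by rewrite series_riemannRE big_nat1 expr1n invr1.
Qed.

End series_bounds.

Section kfree_density.
Context {R : realType}.

Definition density (k : nat) : R := (zeta (k%:R : R))^-1.

Lemma density_gt0 k : (2 <= k)%N -> 0 < density k.
Proof. by move=> k2; rewrite invr_gt0 (lt_le_trans ltr01)// zeta_ge1. Qed.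

Lemma density_le1 k : (2 <= k)%N -> density k <= 1.
Proof. by move=> k2; rewrite invf_le1 ?zeta_ge1// (lt_le_trans ltr01)// zeta_ge1. Qed.

Lemma truncn_divn (x : R) d : 0 <= x -> (0 < d)%N ->
  Num.truncn (x / d%:R) = (Num.truncn x %/ d)%N.
Proof.
move=> x0 d0; have d0R : 0 < d%:R :> R by rewrite ltr0n.
apply: truncn_def; rewrite ler_pdivlMr// ltr_pdivrMr//.
have /andP[lx xl] := truncn_itv x0.
apply/andP; split.
  by apply: le_trans lx; rewrite -natrM ler_nat leq_divM.
by apply: (lt_le_trans xl); rewrite -natrM ler_nat ltn_ceil.
Qed.

Lemma kfree_count_le k N : (kfree_count k N <= N)%N.
Proof.
by rewrite /kfree_count /kfree_upto size_filter (leq_trans (count_size _ _))// size_iota.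
Qed.

(** The tail of the zeta series, used to truncate the sum over b at the cost of
    a bounded error. *)
Lemma near_density_series k (x : R) : (2 <= k)%N -> 0 < x ->
  \forall B \near \oo, x * (1 - density k * series (riemannR (k%:R : R)) B) <= 1.
Proof.
move=> k2 x0; have z1 := @zeta_ge1 R k k2.
have z0 : 0 < zeta (k%:R : R) by apply: lt_le_trans z1.
have e0 : 0 < zeta (k%:R : R) / x by rewrite divr_gt0.
have /cvgrPdist_le/(_ _ e0) := @cvg_series_riemannR R k k2.
apply: filterS => B /ler_normlW; rewrite /density.
set S := series _ B; set z := zeta _ in z1 z0 e0 *.
rewrite ler_pdivlMr// => h.
have -> : x * (1 - z^-1 * S) = ((z - S) * x) / z by field; rewrite gt_eqF.
by rewrite ler_pdivrMr// mul1r.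
Qed.

(** Induction on the integer part of x; the constant 22 works because
    2 + 22 * 29 / 32 <= 22. *)
Lemma kfree_count_estimate k (x : R) : (2 <= k)%N -> 0 <= x ->
  `|(kfree_count k (Num.truncn x))%:R - density k * x| <= 22 * x `^ saving.
Proof.
move=> k2; have k0 : (0 < k)%N by apply: leq_trans k2.
have d0 := density_gt0 k2; have d1 := density_le1 k2.
have small y : 0 <= y -> y < 1 ->
    `|(kfree_count k (Num.truncn y))%:R - density k * y| <= 22 * y `^ saving.
  move=> y0 y1; have /truncn0Pn -> : ~~ (1 <= y) by rewrite -ltNge.
  rewrite sub0r normrN ger0_norm ?mulr_ge0// ?(ltW d0)//.
  apply: (@le_trans _ _ y); first by rewrite ler_piMl.
  apply: (@le_trans _ _ (y `^ saving)); last by rewrite ler_peMl ?powR_ge0//; lra.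
  have [->|yn0] := eqVneq y 0; first exact: powR_ge0.
  rewrite -[leLHS]powRr1//; apply: ger_powR; last by rewrite /saving; lra.
  by rewrite lt_neqAle eq_sym yn0 y0 ltW.
have [N xN] : exists N, (Num.truncn x <= N)%N by exists (Num.truncn x).
elim: N x xN => [|N IH] x xN x0; have [x1|x1] := ltP x 1.
- exact: small.
- by move: xN; rewrite leqn0 -leqn0 leqNgt truncn_gt0 x1.
- exact: small.
have xgt0 : 0 < x by apply: lt_le_trans x1.
have [B [NB hB]] : exists B, (Num.truncn x <= B)%N /\
    x * (1 - density k * series (riemannR (k%:R : R)) B) <= 1.
  near \oo => B; exists B; split; near: B; first exact: nbhs_infty_ge.
  exact: near_density_series.
have B0 : (0 < B)%N by apply: leq_trans NB; rewrite truncn_gt0.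
move: hB (sum_kfree_count k0 NB); rewrite series_riemannRE.
rewrite !(big_ltn (_ : 1 < B.+1)%N)// exp1n divn1 expr1n invr1.
set S := \sum_(_ <= _ < _) _ => hB /(congr1 (fun m => m%:R : R)).
rewrite natrD natr_sum => hN.
have xA : 1 <= x `^ saving by rewrite -(powRr0 x) ler_powR// /saving; lra.
(* [E b] is the error term at x / b ^ k. *)
pose E b : R := (kfree_count k (Num.truncn x %/ b ^ k))%:R - density k * (x / (b ^ k)%:R).
have EE : (kfree_count k (Num.truncn x))%:R - density k * x =
    ((Num.truncn x)%:R - density k * (x * (1 + S))) - \sum_(2 <= b < B.+1) E b.
  have -> : \sum_(2 <= b < B.+1) E b =
      \sum_(2 <= b < B.+1) (kfree_count k (Num.truncn x %/ b ^ k))%:R - density k * (x * S).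
    rewrite /E sumrB; congr (_ - _); rewrite /S 2!mulr_sumr.
    by apply: eq_bigr => b _; rewrite natrX.
  by rewrite -hN; ring.
have Esum : `|\sum_(2 <= b < B.+1) E b| <= 22 * x `^ saving * (29 / 32).
  apply: le_trans (ler_norm_sum _ _ _) _.
  apply: le_trans (_ : 22 * x `^ saving *
      \sum_(2 <= b < B.+1) ((b%:R ^+ k)^-1) `^ saving <= _); last first.
    by rewrite ler_wpM2l ?sum_saving_weight_le// mulr_ge0 ?powR_ge0.
  rewrite mulr_sumr big_nat [leRHS]big_nat; apply: ler_sum => b /andP[b2 _].
  have b0 : (0 < b ^ k)%N by rewrite expn_gt0 (ltnW b2).
  rewrite /E -truncn_divn// -natrX -mulrA -powRM ?invr_ge0 ?ler0n//.
  apply: IH; last by rewrite divr_ge0 ?ler0n.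
  rewrite truncn_divn// -ltnS; apply: leq_trans xN.
  rewrite ltn_Pdiv ?truncn_gt0//; apply: (leq_trans b2).
  by rewrite -[X in (X <= _)%N]expn1 leq_pexp2l// ltnW.
rewrite EE; apply: le_trans (ler_normB _ _) _.
suff : `|(Num.truncn x)%:R - density k * (x * (1 + S))| <= 2 by lra.
have /andP[lx xl] := truncn_itv x0; rewrite -natr1 in xl.
have zS : density k * (1 + S) <= 1.
  have z0 : 0 < zeta (k%:R : R) by apply: lt_le_trans (zeta_ge1 k2).
  rewrite /density mulrC ler_pdivrMr// mul1r.
  have := nondecreasing_cvgn_le (@nondecreasing_series_riemannR R k)
    (cvgP _ (cvg_series_riemannR k2)) B.
  by rewrite series_riemannRE big_ltn// expr1n invr1.
have : density k * (x * (1 + S)) <= x by nra.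
by rewrite ler_norml; nra.
Unshelve. all: by end_near.
Qed.

End kfree_density.

(** * Lattice points with k-free coordinates *)

Section grid.
Variables (R : realType) (k N : nat).

Fixpoint kfree_grid (n : nat) : seq (n.-tuple nat) :=
  if n is n'.+1 then
    [seq cons_tuple m u | m <- kfree_upto k N, u <- kfree_grid n']
  else [:: [tuple]].

Definition natr_tuple n (u : n.-tuple nat) : n.-tuple R := [tuple of [seq j%:R | j <- u]].

Definition grid_count n (D : set (n.-tuple R)) : nat :=
  count (fun u => `[< D (natr_tuple u) >]) (kfree_grid n).

Definition slice n (D : set (n.+1.-tuple R)) (x : R) : set (n.-tuple R) :=
  [set y | D (pcons (x, y))].

Lemma kfree_upto_uniq : uniq (kfree_upto k N).
Proof. by rewrite filter_uniq// iota_uniq. Qed.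

Lemma mem_kfree_upto m : (m \in kfree_upto k N) = (m <= N)%N && `[< kfree k m >].
Proof.
rewrite mem_filter mem_iota andbC add1n ltnS.
by apply: andb_id2r => /asboolP[-> _].
Qed.

Lemma kfree_grid_uniq n : uniq (kfree_grid n).
Proof.
elim: n => //= n IH; apply: allpairs_uniq => //; first exact: kfree_upto_uniq.
move=> [m u] [m' u'] _ _ /= /(congr1 val)/= [-> uu].
by congr pair; exact: val_inj.
Qed.

Lemma mem_kfree_grid n (u : n.-tuple nat) :
  reflect (forall i, (tnth u i <= N)%N /\ kfree k (tnth u i)) (u \in kfree_grid n).
Proof.
elim: n u => [|n IH] u /=.
  have -> : (u \in [:: [tuple]]) = true by rewrite mem_seq1; apply/eqP; exact: tuple0.
  by constructor; case.
apply: (iffP allpairsP) => [[[m v] /= [mN vN ->]] i|uN].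
  have [j ->|->] := unliftP ord0 i.
    by rewrite tnthS; exact/IH.
  by rewrite tnth0; move: mN; rewrite mem_kfree_upto => /andP[-> /asboolP].
exists (thead u, [tuple of behead u]) => /=; split.
- by rewrite mem_kfree_upto; have [-> /asboolP] := uN ord0.
- by apply/IH => i; have := uN (lift ord0 i); rewrite [in tnth u _](tuple_eta u) tnthS.
- exact: tuple_eta.
Qed.

(** Slicing along the first coordinate, the one that [lebesgue_tuple] integrates
    on its own. *)
Lemma grid_countS n (D : set (n.+1.-tuple R)) :
  grid_count D = \sum_(m <- kfree_upto k N) grid_count (slice D m%:R).
Proof.
rewrite /grid_count -sum1_count big_mkcond /= big_allpairs_dep.
apply: eq_bigr => m _; rewrite -sum1_count [RHS]big_mkcond; apply: eq_bigr => u _.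
congr (if `[< D _ >] then _ else _); exact/val_inj.
Qed.

Lemma grid_count_le n (D D' : set (n.-tuple R)) :
  (forall u, (forall i, kfree k (tnth u i)) -> D (natr_tuple u) -> D' (natr_tuple u)) ->
  (grid_count D <= grid_count D')%N.
Proof.
move=> DD'; rewrite /grid_count -!size_filter uniq_leq_size ?filter_uniq ?kfree_grid_uniq//.
move=> u; rewrite !mem_filter => /andP[/asboolP Du uN]; rewrite uN andbT.
by apply/asboolP/DD' => // i; have /mem_kfree_grid/(_ i)[] := uN.
Qed.

(** Any bound N on the coordinates of the points of D may be used, which lets
    several sets be counted on one grid. *)
Lemma card_kfree_points n (D : set (n.-tuple R)) :
  (forall u, D (natr_tuple u) -> forall i, (tnth u i <= N)%N) ->
  #|` fset_set [set u : n.-tuple nat | D (natr_tuple u) /\ forall i, kfree k (tnth u i)]|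
    = grid_count D.
Proof.
move=> DN; set A := [set u | _].
pose s := [seq u <- kfree_grid n | `[< D (natr_tuple u) >]].
have su : uniq s by rewrite filter_uniq// kfree_grid_uniq.
have -> : A = [set` [fset u in s]%fset].
  apply/seteqP; split => u /=; rewrite inE /= mem_filter.
    move=> [Du ku]; apply/andP; split; first exact/asboolP.
    by apply/mem_kfree_grid => i; split; [exact: DN|exact: ku].
  move=> /andP[/asboolP Du /mem_kfree_grid uN]; split => // i.
  by have [] := uN i.
rewrite set_fsetK /grid_count -size_filter card_fseq.
by rewrite undup_id.
Qed.

End grid.

Section interval.
Variables (R : realType) (k : nat) (k2 : (2 <= k)%N).
Implicit Types (L x : R) (I : set R).

Lemma kfree_upto_truncn L x : x <= L ->
  kfree_count k (Num.truncn x) =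
    count (fun m => m <= Num.truncn x)%N (kfree_upto k (Num.truncn L)).
Proof.
move=> xL; rewrite /kfree_count -size_filter; apply/perm_size/uniq_perm.
- exact: kfree_upto_uniq.
- by rewrite filter_uniq// kfree_upto_uniq.
move=> m; rewrite [RHS]mem_filter !mem_kfree_upto andbA; congr (_ && _).
apply/idP/andP => [mx|[]//]; split=> //.
exact: leq_trans mx (le_truncn xL).
Qed.

(** A down-set of [0, L] is an interval from 0 to its supremum a, closed or not
    on the right; the number of its k-free points is that of [0, a], up to the
    point a itself. *)
Lemma kfree_initial_segment L I : 1 <= L -> measurable I ->
  (forall x, I x -> 0 <= x <= L) ->
  (forall x y, I x -> 0 <= y <= x -> I y) ->
  `|(count (fun m => `[< I m%:R >]) (kfree_upto k (Num.truncn L)))%:R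
      - density k * fine (lebesgue_measure I)| <= 23 * L `^ saving.
Proof.
move=> L1 mI IL Idown.
have L0 : 0 <= L by apply: le_trans L1.
have [I0|/set0P[x0 Ix0]] := eqVneq I set0.
  rewrite I0 measure0 mulr0 subr0 (eq_count (a2 := pred0)).
    by rewrite count_pred0 normr0 mulr_ge0// powR_ge0.
  by move=> m; apply/asboolP.
have supI : has_sup I by split; [exists x0|exists L => x /IL/andP[]].
pose a := sup I.
have aL : a <= L by apply: ge_sup => [|x /IL/andP[]//]; exists x0.
have Ia x : I x -> x <= a by move=> Ix; apply: ub_le_sup => //; case: supI.
have a0 : 0 <= a by apply: le_trans (Ia _ Ix0); have /andP[] := IL _ Ix0.
have aI x : 0 <= x -> x < a -> I x.
  move=> xge0 xa; have [y Iy xy] := sup_gt (proj1 supI) xa.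
  by apply: (Idown y) => //; rewrite xge0 ltW.
have -> : fine (lebesgue_measure I) = a.
  suff -> : lebesgue_measure I = a%:E by [].
  apply/eqP; rewrite eq_le; apply/andP; split.
    have -> : a%:E = lebesgue_measure `[0, a]%classic.
      rewrite lebesgue_measure_itv/= lte_fin; case: ltP; first by rewrite oppr0 adde0.
      by move=> a0'; congr (_%:E); apply/eqP; rewrite eq_le a0' a0.
    apply: le_measure; rewrite ?inE//.
    by move=> x Ix /=; rewrite in_itv/= Ia// andbT; have /andP[] := IL _ Ix.
  have -> : a%:E = lebesgue_measure `[0, a[%classic.
    rewrite lebesgue_measure_itv/= lte_fin; case: ltP; first by rewrite oppr0 adde0.
    by move=> a0'; congr (_%:E); apply/eqP; rewrite eq_le a0' a0.
  apply: le_measure; rewrite ?inE//.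
  by move=> x /=; rewrite in_itv/= => /andP[]; exact: aI.
have := kfree_count_estimate k2 a0; rewrite (kfree_upto_truncn aL).
set s := kfree_upto k _; set p : pred nat := fun m => `[< I m%:R >].
have pq : (count p s <= count (fun m => m <= Num.truncn a) s)%N.
  by apply: sub_count => m /asboolP/Ia; rewrite truncn_ge_nat.
have qp : (count (fun m => m <= Num.truncn a) s <= count p s + 1)%N.
  apply: (@leq_trans (count (predU p (pred1 (Num.truncn a))) s)).
    apply: sub_count => m /=; rewrite leq_eqVlt orbC => /orP[ma|->]; last by rewrite orbT.
    apply/orP; left; apply/asboolP/aI => //.
    by apply: lt_le_trans (_ : m.+1%:R <= a); rewrite ?ltr_nat// -truncn_gt_nat.
  apply: (@leq_trans (count p s + count (pred1 (Num.truncn a)) s)).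
    by rewrite -count_predUI leq_addr.
  by rewrite leq_add2l count_uniq_mem ?leq_b1// kfree_upto_uniq.
move: pq qp; rewrite -!(ler_nat R) natrD => pq qp.
have aLs : a `^ saving <= L `^ saving :> R.
  by apply: ge0_ler_powR; rewrite ?nnegrE// /saving; lra.
have Ls1 : 1 <= L `^ saving by rewrite -(powRr0 L) ler_powR// /saving; lra.
by rewrite !ler_norml => /andP[h1 h2]; apply/andP; split; lra.
Qed.

End interval.

(** * Down-sets: lattice points against volume *)

Section iterated_lebesgue.
Variable R : realType.
Implicit Types (n : nat) (L : R).

Definition fiber n (D : set (n.+1.-tuple R)) (y : n.-tuple R) : set R :=
  [set x | D (pcons (x, y))].

Lemma fiberE n (D : set (n.+1.-tuple R)) y : fiber D y = ysection (@pcons R n @^-1` D) y.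
Proof. by apply/seteqP; split => x; rewrite /ysection /= inE. Qed.

Lemma measurable_pcons_preimage n (D : set (n.+1.-tuple R)) :
  measurable D -> measurable (@pcons R n @^-1` D).
Proof. by move=> mD; rewrite -[X in measurable X]setTI; exact: measurable_pcons. Qed.

Lemma measurable_fiber n (D : set (n.+1.-tuple R)) y :
  measurable D -> measurable (fiber D y).
Proof.
by move=> mD; rewrite fiberE; apply: measurable_ysection; exact: measurable_pcons_preimage.
Qed.

Lemma measurable_slice n (D : set (n.+1.-tuple R)) x :
  measurable D -> measurable (slice D x).
Proof.
move=> mD; rewrite (_ : slice D x = xsection (@pcons R n @^-1` D) x).
  by apply: measurable_xsection; exact: measurable_pcons_preimage.
by apply/seteqP; split => y; rewrite /xsection /= inE.
Qed.

(** In the iterated product the inner integral runs over the first coordinate,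
    so fibers over the last n coordinates give the measure. *)
Lemma lebesgue_tupleS n (D : set (n.+1.-tuple R)) :
  lebesgue_tuple n.+1 D = (\int[lebesgue_tuple n]_y lebesgue_measure (fiber D y))%E.
Proof. by under eq_integral => y _ do rewrite fiberE. Qed.

Lemma measurable_fun_fiber n (D : set (n.+1.-tuple R)) : measurable D ->
  measurable_fun setT (fun y => lebesgue_measure (fiber D y)).
Proof.
move=> mD; under eq_fun do rewrite fiberE.
exact: (measurable_fun_ysection lebesgue_measure (measurable_pcons_preimage mD)).
Qed.

Definition box n L : set (n.-tuple R) := [set x | forall i, 0 <= tnth x i <= L].

Lemma measurable_box n L : measurable (@box n L).
Proof.
rewrite (_ : box L = \bigcap_(i in [set: 'I_n]) ((fun x => tnth x i) @^-1` `[0, L]%classic)).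
  apply: fin_bigcap_measurable => // i _; rewrite -[X in measurable X]setTI.
  exact: measurable_tnth.
by apply/seteqP; split => x xL i; have := xL i; rewrite /= in_itv/= => h; auto.
Qed.

Lemma box_pcons n L x (y : n.-tuple R) : box L (pcons (x, y)) <-> 0 <= x <= L /\ box L y.
Proof.
split => [xyL|[xL yL] i].
  split; first by have := xyL ord0.
  by move=> i; have := xyL (lift ord0 i); rewrite tnthS.
by have [j ->|->] := unliftP ord0 i; rewrite ?tnthS.
Qed.

Lemma lebesgue_tuple_box n L : 0 <= L -> lebesgue_tuple n (box L) = (L ^+ n)%:E.
Proof.
move=> L0; elim: n => [|n IH].
  by rewrite /= diracE mem_set//; case.
rewrite lebesgue_tupleS.
transitivity (\int[lebesgue_tuple n]_(y in box L) (cst L%:E y))%E; last first.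
  rewrite integral_cst; last exact: measurable_box.
  by rewrite exprS EFinM -IH.
rewrite [RHS]integral_mkcond; apply: eq_integral => y _.
rewrite patchE; case: ifPn => [/set_mem yL|/negP yL].
  rewrite (_ : fiber _ _ = `[0, L]%classic).
    rewrite lebesgue_measure_itv/= lte_fin; case: ltP; first by rewrite oppr0 adde0.
    by move=> L0'; congr (_%:E); apply/eqP; rewrite eq_le L0' L0.
  apply/seteqP; split => x /=; rewrite in_itv/=.
    by move=> /box_pcons[].
  by move=> xL; apply/box_pcons.
rewrite (_ : fiber _ _ = set0) ?measure0//.
by apply/seteqP; split => x //= /box_pcons[_ /mem_set].
Qed.

End iterated_lebesgue.

Section down_sets.
Variables (R : realType) (k : nat) (k2 : (2 <= k)%N) (L : R) (L1 : 1 <= L).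

Definition down_set n (D : set (n.-tuple R)) : Prop :=
  forall x y, D x -> (forall i, 0 <= tnth y i <= tnth x i) -> D y.

Let N := Num.truncn L.
Let L0 : 0 <= L. Proof. exact: le_trans L1. Qed.

Lemma slice_box n (D : set (n.+1.-tuple R)) x :
  D `<=` box L -> slice D x `<=` box L.
Proof. by move=> DL y /DL/box_pcons[]. Qed.

Lemma slice_down_set n (D : set (n.+1.-tuple R)) x :
  D `<=` box L -> down_set D -> down_set (slice D x).
Proof.
move=> DL dD y z Dy zy.
have [/andP[x0 _] _] := (box_pcons L x y).1 (DL _ Dy).
apply: dD Dy _ => i.
by have [j ->|->] := unliftP ord0 i; rewrite ?tnthS//= x0 lexx.
Qed.

Lemma fiber_initial_segment n (D : set (n.+1.-tuple R)) y :
  measurable D -> D `<=` box L -> down_set D ->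
  `|(count (fun m => `[< fiber D y m%:R >]) (kfree_upto k N))%:R
      - density k * fine (lebesgue_measure (fiber D y))| <= 23 * L `^ saving.
Proof.
move=> mD DL dD; apply: kfree_initial_segment => //.
- exact: measurable_fiber.
- by move=> x /DL/box_pcons[].
move=> x z Dx zx.
have [_ yL] := (box_pcons L x y).1 (DL _ Dx).
apply: dD Dx _ => i.
have [j ->|->] := unliftP ord0 i; rewrite ?tnthS//= lexx andbT.
by have /andP[] := yL j.
Qed.

Lemma fiber_out n (D : set (n.+1.-tuple R)) y :
  D `<=` box L -> ~ box L y -> fiber D y = set0.
Proof. by move=> DL yL; apply/seteqP; split => x //= /DL/box_pcons[]. Qed.

Lemma lebesgue_fiber_fin n (D : set (n.+1.-tuple R)) y :
  measurable D -> D `<=` box L -> lebesgue_measure (fiber D y) \is a fin_num.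
Proof.
move=> mD DL; rewrite ge0_fin_numE//.
apply: (@le_lt_trans _ _ (lebesgue_measure `[0, L]%classic)).
  apply: le_measure; rewrite ?inE//; first exact: measurable_fiber.
  by move=> x /DL/box_pcons[xL _]; rewrite /= in_itv.
by rewrite lebesgue_measure_itv/=; case: ifP => _; rewrite ?ltry// -EFinD ltry.
Qed.

Lemma lebesgue_tuple_fin n (D : set (n.-tuple R)) :
  measurable D -> D `<=` box L -> lebesgue_tuple n D \is a fin_num.
Proof.
move=> mD DL; rewrite ge0_fin_numE//.
apply: (@le_lt_trans _ _ (lebesgue_tuple n (box L))).
  by apply: le_measure; rewrite ?inE//; exact: measurable_box.
by rewrite lebesgue_tuple_box// ltry.
Qed.

(** Finite Fubini: integrating over y the number of k-free points of the fiber
    over y counts every slice with its volume. *)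
Lemma sum_slices n (D : set (n.+1.-tuple R)) :
  measurable D -> D `<=` box L ->
  (\int[lebesgue_tuple n]_y
     ((count (fun m => `[< fiber D y m%:R >]) (kfree_upto k N))%:R)%:E)%E =
  (\sum_(m <- kfree_upto k N) fine (lebesgue_tuple n (slice D m%:R)))%:E.
Proof.
move=> mD DL.
transitivity (\int[lebesgue_tuple n]_y \sum_(m <- kfree_upto k N)
    (\1_(slice D m%:R) y)%:E)%E.
  apply: eq_integral => y _; rewrite sumEFin; congr (_%:E).
  rewrite -sum1_count natr_sum big_mkcond; apply: eq_bigr => m _.
  by rewrite indicE; case: asboolP => h; [rewrite mem_set|rewrite memNset].
rewrite ge0_integral_sum//; last first.
  by move=> m; apply/measurable_EFinP; apply: measurable_indic; exact: measurable_slice.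
rewrite -sumEFin; apply: eq_bigr => m _.
rewrite integral_indic ?setIT//; last exact: measurable_slice.
by rewrite fineK// lebesgue_tuple_fin//; [exact: measurable_slice|exact: slice_box].
Qed.

Lemma measurable_count_fiber n (D : set (n.+1.-tuple R)) : measurable D ->
  measurable_fun setT (fun y =>
    ((count (fun m => `[< fiber D y m%:R >]) (kfree_upto k N))%:R)%:E : \bar R).
Proof.
move=> mD; apply/measurable_EFinP.
rewrite (_ : (fun y => _) = (fun y => \sum_(m <- kfree_upto k N) \1_(slice D m%:R) y)).
  by apply: measurable_sum => m; apply: measurable_indic; exact: measurable_slice.
apply/funext => y; rewrite -sum1_count natr_sum big_mkcond; apply: eq_bigr => m _.
by rewrite indicE; case: asboolP => h; [rewrite mem_set|rewrite memNset].
Qed.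

(** Exchange of the two measures in the first coordinate: on every fiber the
    one-dimensional estimate applies, and only y in the box contribute. *)
Lemma sum_slices_estimate n (D : set (n.+1.-tuple R)) :
  measurable D -> D `<=` box L -> down_set D ->
  `|\sum_(m <- kfree_upto k N) fine (lebesgue_tuple n (slice D m%:R))
     - density k * fine (lebesgue_tuple n.+1 D)| <= 23 * L `^ saving * L ^+ n.
Proof.
move=> mD DL dD.
have c0 : 0 <= density k :> R by exact/ltW/density_gt0.
set K : R := 23 * L `^ saving.
have K0 : 0 <= K by rewrite mulr_ge0// powR_ge0.
pose F y : R := (count (fun m => `[< fiber D y m%:R >]) (kfree_upto k N))%:R.
pose G y := lebesgue_measure (fiber D y).
have FG y : `|F y - density k * fine (G y)| <= K * \1_(box L) y.
  rewrite indicE; case: (pselect (box L y)) => yL.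
    by rewrite mem_set// mulr1; exact: fiber_initial_segment.
  rewrite memNset// mulr0 /F /G (fiber_out DL yL) measure0 mulr0 subr0.
  by rewrite (eq_count (a2 := pred0)) ?count_pred0 ?normr0// => m; apply/asboolP.
clearbody K.
have GE y : G y = (fine (G y))%:E by rewrite fineK// lebesgue_fiber_fin.
have mF : measurable_fun setT (EFin \o F) by exact: measurable_count_fiber.
have mG : measurable_fun setT G by exact: measurable_fun_fiber.
have mB : measurable_fun setT (fun y : n.-tuple R => (K%:E * (\1_(box L) y)%:E)%E).
  apply: measurable_funeM; apply/measurable_EFinP.
  by apply: measurable_indic; exact: measurable_box.
pose mu : {measure set (n.-tuple R) -> \bar R} := lebesgue_tuple n.
have intF : (\int[mu]_y (F y)%:E)%E =
  (\sum_(m <- kfree_upto k N) fine (lebesgue_tuple n (slice D m%:R)))%:E.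
  exact: sum_slices.
have intG : (\int[mu]_y (G y))%E = (fine (lebesgue_tuple n.+1 D))%:E.
  by rewrite fineK ?lebesgue_tuple_fin// lebesgue_tupleS.
have intB : (\int[mu]_y (\1_(box L) y)%:E)%E = (L ^+ n)%:E.
  by rewrite integral_indic ?setIT//; [exact: lebesgue_tuple_box|exact: measurable_box].
have m1B : measurable_fun setT (fun y : n.-tuple R => (\1_(box L) y)%:E : \bar R).
  by apply/measurable_EFinP; apply: measurable_indic; exact: measurable_box.
have h1 : (\int[mu]_y (F y)%:E <=
    \int[mu]_y ((density k)%:E * G y + K%:E * (\1_(box L) y)%:E))%E.
  apply: ge0_le_integral => //.
  - by move=> y _; rewrite lee_fin.
  - by apply: emeasurable_funD => //; exact: measurable_funeM.
  move=> y _; rewrite GE -!EFinM -EFinD lee_fin.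
  by have := FG y; rewrite ler_norml => /andP[_]; rewrite lerBlDl.
have h2 : (\int[mu]_y ((density k)%:E * G y) <=
    \int[mu]_y ((F y)%:E + K%:E * (\1_(box L) y)%:E))%E.
  apply: ge0_le_integral => //.
  - by move=> y _; rewrite mule_ge0.
  - exact: measurable_funeM.
  - by apply: emeasurable_funD.
  move=> y _; rewrite GE -!EFinM -EFinD lee_fin.
  by have := FG y; rewrite ler_norml => /andP[+ _]; rewrite lerNl opprB lerBlDl.
move: h1 h2.
have F0 y : [set: n.-tuple R] y -> (0 <= (F y)%:E)%E by rewrite lee_fin.
have G0 y : [set: n.-tuple R] y -> (0 <= (density k)%:E * G y)%E by rewrite mule_ge0.
have B0 y : [set: n.-tuple R] y -> (0 <= K%:E * (\1_(box L) y)%:E)%E.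
  by rewrite -EFinM lee_fin mulr_ge0.
have mcG : measurable_fun setT (fun y => (density k)%:E * G y)%E by exact: measurable_funeM.
rewrite !ge0_integralD//.
rewrite !ge0_integralZl// intF intG intB -!EFinM -!EFinD !lee_fin.
by move=> h1 h2; rewrite ler_norml; apply/andP; split; lra.
Qed.

(** By induction on n, the slices D_m being down-sets in the box: first the last
    n coordinates are exchanged in each of the at most L slices, then the first
    one. *)
Lemma grid_count_estimate n (D : set (n.-tuple R)) :
  measurable D -> D `<=` box L -> down_set D ->
  `|(grid_count k N D)%:R - density k ^+ n * fine (lebesgue_tuple n D)|
    <= 23 * n%:R * (L `^ saving * L ^+ n.-1).
Proof.
have d0 := @density_gt0 R k k2; have d1 := @density_le1 R k k2.
elim: n D => [|n IH] D mD DL dD.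
  rewrite expr0 mul1r mulr0 mul0r.
  have -> : lebesgue_tuple 0 D = \d_([tuple] : 0.-tuple R) D by [].
  rewrite diracE /grid_count /= addn0 (tuple0 (natr_tuple _ _)).
  by case: asboolP => h; [rewrite mem_set|rewrite memNset]; rewrite //= subrr normr0.
rewrite grid_countS natr_sum.
set X := \sum_(_ <- _) _; set Z := fine _.
pose Y := \sum_(m <- kfree_upto k N) fine (lebesgue_tuple n (slice D m%:R)).
have -> : X - density k ^+ n.+1 * Z =
    (X - density k ^+ n * Y) + density k ^+ n * (Y - density k * Z).
  by rewrite exprS; ring.
have XY : `|X - density k ^+ n * Y| <= 23 * n%:R * (L `^ saving * L ^+ n).
  rewrite /X /Y mulr_sumr -sumrB; apply: le_trans (ler_norm_sum _ _ _) _.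
  apply: (@le_trans _ _ (\sum_(m <- kfree_upto k N)
      23 * n%:R * (L `^ saving * L ^+ n.-1))).
    apply: ler_sum => m _; apply: IH.
    - exact: measurable_slice.
    - exact: slice_box.
    - exact: slice_down_set.
  rewrite big_const_seq count_predT iter_addr_0 -[leLHS]mulr_natr.
  case: n {IH D mD DL dD X Z Y} => [|n]; first by rewrite !mulr0 !mul0r.
  rewrite -!mulrA ler_wpM2l// ler_wpM2l ?ler0n// ler_wpM2l ?powR_ge0//=.
  rewrite exprSr ler_wpM2l ?exprn_ge0//.
  apply: (@le_trans _ _ N%:R); last by rewrite truncn_le.
  by rewrite ler_nat; exact: kfree_count_le.
apply: le_trans (ler_normD _ _) _; rewrite normrM.
have YZ : `|Y - density k * Z| <= 23 * L `^ saving * L ^+ n by exact: sum_slices_estimate.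
have : `|density k ^+ n| * `|Y - density k * Z| <= 23 * L `^ saving * L ^+ n.
  by apply: le_trans YZ; rewrite ler_piMl// normrX exprn_ile1// ?normr_ge0// ger0_norm// ltW.
by rewrite -natr1/= => YZ'; lra.
Qed.

End down_sets.

(** * Dilations and Lebesgue measure *)

Section dilation.
Variable R : realType.
Implicit Types (n : nat) (r : R).

Definition dilate r n (x : n.-tuple R) : n.-tuple R := [tuple r * tnth x i | i < n].

Arguments dilate r {n} x.

Lemma tnth_dilate r n (x : n.-tuple R) i : tnth (dilate r x) i = r * tnth x i.
Proof. exact: tnth_mktuple. Qed.

Lemma measurable_dilate r n : measurable_fun setT (dilate r (n := n)).
Proof.
apply/measurable_fun_tnthP => i.
rewrite (_ : _ \o _ = fun x => r * tnth x i); last first.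
  by apply/funext => x /=; rewrite tnth_dilate.
by apply: measurable_funM => //; exact: measurable_tnth.
Qed.

Lemma dilate_pcons r n x (y : n.-tuple R) :
  dilate r (pcons (x, y)) = pcons (r * x, dilate r y).
Proof.
apply: eq_from_tnth => i; rewrite tnth_dilate.
by have [j ->|->] := unliftP ord0 i; rewrite ?tnthS ?tnth_dilate.
Qed.

(** Both sides of the relation, multiplied by r, are measures that agree on
    half-open intervals. *)
Lemma lebesgue_measure_dilate r (A : set R) : 0 < r -> measurable A ->
  lebesgue_measure ( *%R r @^-1` A) = (r^-1%:E * lebesgue_measure A)%E.
Proof.
move=> r0 mA.
pose phi : measurableTypeR R -> measurableTypeR R := *%R r.
have mr : measurable_fun setT phi by exact: measurable_funM.
pose push : {measure set (measurableTypeR R) -> \bar R} :=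
  measure_function_pushforward__canonical__measure_function_Measure lebesgue_measure mr.
pose nu : {measure set (measurableTypeR R) -> \bar R} := mscale (NngNum (ltW r0)) push.
have nuE B : nu B = (r%:E * lebesgue_measure ( *%R r @^-1` B))%E by [].
have -> : lebesgue_measure A = nu A.
  apply: lebesgue_measure_unique => // _ [[a b] /= _ <-].
  rewrite nuE (_ : _ @^-1` _ = `]r^-1 * a, r^-1 * b]%classic); last first.
    apply/seteqP; split => x /=; rewrite !in_itv/=.
      by rewrite ltr_pdivrMl// ler_pdivlMl.
    by rewrite ltr_pdivrMl// ler_pdivlMl.
  rewrite !lebesgue_measure_itv/= !lte_fin ltr_pM2l ?invr_gt0//.
  case: ifP => _; last by rewrite mule0.
  by rewrite -!EFinB -EFinM -mulrBr mulrA mulfV ?gt_eqF// mul1r.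
by rewrite nuE muleA -EFinM mulVf ?gt_eqF// mul1e.
Qed.

(** Induction on n: the fibers of a dilated set are dilated fibers, and the
    integral over the remaining coordinates is an integral for the image of
    [lebesgue_tuple n] under the dilation. *)
Lemma lebesgue_tuple_dilate r n (A : set (n.-tuple R)) : 0 < r -> measurable A ->
  lebesgue_tuple n (dilate r @^-1` A) = ((r^-1 ^+ n)%:E * lebesgue_tuple n A)%E.
Proof.
move=> r0; elim: n A => [|n IH] A mA.
  rewrite expr0 mul1e; congr (lebesgue_tuple _ _).
  by apply/seteqP; split => x /=; rewrite (tuple0 (dilate r x)) (tuple0 x).
have ri0 : 0 <= r^-1 ^+ n by rewrite exprn_ge0// invr_ge0 ltW.
pose mu : {measure set (n.-tuple R) -> \bar R} := lebesgue_tuple n.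
pose push : {measure set (n.-tuple R) -> \bar R} :=
  measure_function_pushforward__canonical__measure_function_Measure mu (@measurable_dilate r n).
have mF := measurable_fun_fiber mA.
have -> : lebesgue_tuple n.+1 A = (\int[mu]_y lebesgue_measure (fiber A y))%E.
  exact: lebesgue_tupleS.
rewrite lebesgue_tupleS.
transitivity (\int[mu]_y (r^-1%:E * lebesgue_measure (fiber A (dilate r y))))%E.
  apply: eq_integral => y _; rewrite -lebesgue_measure_dilate//; last exact: measurable_fiber.
  by congr lebesgue_measure; apply/seteqP; split => x; rewrite /fiber /= dilate_pcons.
rewrite ge0_integralZl//; last 2 first.
- by apply: (measurableT_comp mF); exact: measurable_dilate.
- by rewrite lee_fin invr_ge0 ltW.
transitivity (r^-1%:E * \int[push]_y lebesgue_measure (fiber A y))%E.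
  by congr (_ * _)%E; rewrite ge0_integral_pushforward//; exact: measurable_dilate.
rewrite exprS EFinM -muleA; congr (_ * _)%E.
rewrite -(ge0_integral_mscale mu measurableT (NngNum ri0))//.
apply: eq_measure_integral => B mB _.
exact: IH.
Qed.

End dilation.
Arguments dilate {R} r {n} x.

(** * Integration in polar coordinates *)

Section polar.
Import HBNNSimple.
Variables (R : realType) (n : nat) (n0 : (0 < n)%N).
Local Notation T := (n.-tuple R).
Local Notation leb := (lebesgue_tuple (R := R) n).
Implicit Types (x : T) (A : set T) (r a : R).

Lemma enorm_ge0 x : 0 <= enorm x.
Proof. exact: sqrtr_ge0. Qed.

Lemma enorm_dilate r x : 0 < r -> enorm (dilate r x) = r * enorm x.
Proof.
move=> r0; rewrite /enorm; under eq_bigr do rewrite tnth_dilate exprMn.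
by rewrite -mulr_sumr sqrtrM ?sqr_ge0// sqrtr_sqr gtr0_norm.
Qed.

Lemma udir_dilate r x : 0 < r -> udir (dilate r x) = udir x.
Proof.
move=> r0; apply: eq_from_tnth => i; rewrite !tnth_mktuple enorm_dilate//.
by rewrite invfM mulrACA mulVf ?gt_eqF// mul1r.
Qed.

Lemma measurable_udir_preimage A : measurable A -> measurable (udir @^-1` A).
Proof. by move=> mA; rewrite -[X in measurable X]setTI; exact: measurable_udir. Qed.

Lemma measurable_enorm_preimage (B : set R) : measurable B -> measurable (@enorm R n @^-1` B).
Proof. by move=> mB; rewrite -[X in measurable X]setTI; exact: measurable_enorm. Qed.

Lemma leb_ge0 A : (0 <= leb A)%E.
Proof. exact: measure_ge0. Qed.

(** The solid cone over A, truncated at radius a.  The sphere of radius a is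
    left out to match the strict inequality that defines star regions. *)
Definition open_cone a A : set T := [set x | 0 < enorm x < a] `&` udir @^-1` A.

Lemma measurable_open_cone a A : measurable A -> measurable (open_cone a A).
Proof.
move=> mA; apply: measurableI; last exact: measurable_udir_preimage.
rewrite (_ : [set x | _] = @enorm R n @^-1` `]0, a[%classic).
  exact: measurable_enorm_preimage.
by apply/seteqP; split => x /=; rewrite in_itv.
Qed.

Lemma lebesgue_open_cone a A : 0 < a -> measurable A ->
  leb (open_cone a A) = ((a ^+ n)%:E * leb (open_cone 1 A))%E.
Proof.
move=> a0 mA; have ai : 0 < a^-1 by rewrite invr_gt0.
rewrite -[a in RHS]invrK -lebesgue_tuple_dilate//; last exact: measurable_open_cone.
congr (leb _); apply/seteqP; split => x; rewrite /open_cone /= enorm_dilate// udir_dilate//.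
  by move=> [/andP[x0 xa] Ax]; rewrite mulr_gt0// ltr_pdivrMl// mulr1 xa.
by rewrite pmulr_rgt0// ltr_pdivrMl// mulr1.
Qed.

(** The unit sphere has volume 0: the closed cone lies in the open cones of
    radii 1 + 1 / (m + 1), whose volumes tend to that of the open cone of
    radius 1 by homogeneity. *)
Lemma lebesgue_punctured_ball_cone A : measurable A ->
  leb (punctured_ball `&` udir @^-1` A) = leb (open_cone 1 A).
Proof.
move=> mA; have mO := @measurable_open_cone 1 A mA.
have mP : measurable (punctured_ball `&` @udir R n @^-1` A).
  by apply: measurableI; [exact: measurable_punctured_ball|exact: measurable_udir_preimage].
apply/eqP; rewrite eq_le; apply/andP; split; last first.
  by apply: le_measure; rewrite ?inE// => x [/= /andP[x0 /ltW x1] Ax]; split => //; apply/andP.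
have up m : (leb (punctured_ball `&` udir @^-1` A) <=
    ((1 + m.+1%:R^-1) ^+ n)%:E * leb (open_cone 1 A))%E.
  have m0 : 0 < m.+1%:R^-1 :> R by rewrite invr_gt0.
  have m1 : 0 < 1 + m.+1%:R^-1 :> R by rewrite addr_gt0.
  rewrite -lebesgue_open_cone//.
  apply: le_measure; rewrite ?inE//; first exact: measurable_open_cone.
  move=> x [/= /andP[x0 x1] Ax]; split => //=.
  by rewrite x0 (le_lt_trans x1)// ltrDl.
case: (leb (open_cone 1 A)) up (leb_ge0 (open_cone 1 A)) => [w up w0|_ _|_];
  [|by rewrite leey|by rewrite leNgt ltNy0].
have cv : (fun m => ((1 + @harmonic R m) ^+ n * w)) @ \oo --> ((1 + 0) ^+ n * w).
  apply: cvgM; last exact: cvg_cst.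
  apply: (cvg_comp _ (fun x : R => x ^+ n)); last exact: exprn_continuous.
  by apply: cvgD; [exact: cvg_cst|exact: cvg_harmonic].
rewrite addr0 expr1n mul1r in cv.
move: up; case: (leb _) (leb_ge0 (punctured_ball `&` udir @^-1` A))
  => [p _ up|_ /(_ 0%N)|]; last by rewrite leNgt ltNy0.
  rewrite lee_fin; rewrite -(cvg_lim _ cv)//; apply: limr_ge; first exact: cvgP cv.
  by apply: nearW => m; rewrite -lee_fin EFinM; exact: up.
by rewrite -EFinM leNgt ltry.
Qed.

(** The star-shaped set with radial function h ^ (1 / n); taking the n-th power
    makes its volume linear in h. *)
Definition star_region (h : T -> R) : set T :=
  [set x | 0 < enorm x /\ enorm x ^+ n < h (udir x)].

Lemma measurable_star_region (h : T -> R) : measurable_fun setT h -> measurable (star_region h).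
Proof.
move=> mh; rewrite (_ : star_region h =
  (@enorm R n @^-1` `]0, +oo[%classic) `&`
  ((fun x => h (udir x) - enorm x ^+ n) @^-1` `]0, +oo[%classic)); last first.
  by apply/seteqP; split => x /=; rewrite !in_itv/= !andbT subr_gt0.
apply: measurableI; first exact: measurable_enorm_preimage.
rewrite -[X in measurable X]setTI.
suff mg : measurable_fun setT (fun x => h (udir x) - enorm x ^+ n) by exact: mg.
apply: measurable_funB; first by apply: (measurableT_comp mh); exact: measurable_udir.
by apply: measurable_funX; exact: measurable_enorm.
Qed.

(** The case of a constant radial function on a set of directions. *)
Lemma lebesgue_level_cone a A : 0 <= a -> measurable A ->
  (n%:R%:E * leb (star_region (cst a) `&` udir @^-1` A) =
    a%:E * surface_measure A)%E.
Proof.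
move=> a0 mA; rewrite /surface_measure lebesgue_punctured_ball_cone// muleCA.
congr (_ * _)%E; case: (ltgtP 0 a) a0 => // [a0 _|<- _]; last first.
  rewrite mul0e (_ : _ `&` _ = set0) ?measure0//.
  apply/seteqP; split => x //= [[x0 xn] _].
  by move: xn; rewrite ltNge exprn_ge0// enorm_ge0.
pose b : R := a `^ n%:R^-1.
have b0 : 0 < b by rewrite powR_gt0.
have ba : b ^+ n = a.
  by rewrite -powR_mulrn ?powR_ge0// -powRrM mulVf ?pnatr_eq0 ?gtn_eqF// powRr1 ?ltW.
rewrite -{2}ba -lebesgue_open_cone//; congr (leb _).
apply/seteqP; split => x /=.
  move=> [[x0 xa] Ax]; split => //=; rewrite x0 ltNge/=; apply/negP => bx.
  by move: xa; rewrite ltNge -ba lerXn2r// nnegrE ?enorm_ge0// ltW.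
move=> [/andP[x0 xb] Ax]; split => //; split => //; rewrite -ba.
by rewrite ltrXn2r// ?gtn_eqF// enorm_ge0.
Qed.

(** A simple function f cuts its star region into finitely many truncated cones,
    one for each value. *)
Lemma surface_sintegral (f : {nnsfun T >-> R}) :
  sintegral (@surface_measure R n) f = (n%:R%:E * leb (star_region f))%E.
Proof.
rewrite sintegralE.
pose S a := star_region (cst a) `&` udir @^-1` (f @^-1` [set a]).
have -> : star_region f = \bigcup_(a in range f) S a.
  apply/seteqP; split => x.
    by move=> [x0 xf]; exists (f (udir x)).
  by move=> [_ [y _ <-]] [[x0 xf] fx]; split => //; rewrite fx.
have mf a : measurable (f @^-1` [set a]) by exact: measurable_funPTI.
have mS a : measurable (S a).
  by apply: measurableI; [exact: measurable_star_region|exact: measurable_udir_preimage].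
have -> : leb (\bigcup_(a in range f) S a) = \sum_(a \in range f) leb (S a).
  rewrite measure_fin_bigcup//.
  by move=> a b _ _ [x [[_ <-] [_ <-]]].
rewrite ge0_mule_fsumr//.
apply: eq_fsbigr => _ /set_mem[y _ <-].
by rewrite lebesgue_level_cone.
Qed.

(** Polar coordinates.  Approximate h from below by simple functions; since the
    inequality in [star_region] is strict, the star region of h is exactly the
    increasing union of those of the approximations. *)
Lemma surface_integral_star_region (h : T -> R) : measurable_fun setT h -> (forall v, 0 <= h v) ->
  (\int[@surface_measure R n]_v (h v)%:E = n%:R%:E * leb (star_region h))%E.
Proof.
move=> mh h0.
have mh' : measurable_fun setT (EFin \o h) by exact/measurable_EFinP.
pose f := nnsfun_approx measurableT mh'.
have f_nd v : nondecreasing_seq (fun m => f m v).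
  by move=> i j ij; have /lefP := nd_nnsfun_approx measurableT mh' ij; apply.
have f_cvg v : (fun m => (f m v)%:E) @ \oo --> (h v)%:E.
  by apply: (cvg_nnsfun_approx measurableT mh') => // w _; rewrite lee_fin.
have f_cvgR v : (fun m => f m v) @ \oo --> h v.
  by have /fine_cvgP[] := f_cvg v.
have f_le m v : f m v <= h v.
  by rewrite -(cvg_lim _ (f_cvgR v))//; apply: nondecreasing_cvgn_le => //; exact: cvgP (f_cvgR v).
rewrite (@nd_ge0_integral_lim _ _ _ _ (EFin \o h) f)//.
rewrite (_ : _ \o _ = fun m => n%:R%:E * leb (star_region (f m)))%E; last first.
  by apply/funext => m; exact: surface_sintegral.
apply/cvg_lim => //; apply: cvgeZl => //.
have -> : star_region h = \bigcup_m star_region (f m).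
  apply/seteqP; split => x.
    move=> [x0 xh]; have [m _ /(_ m (leqnn m)) xf] := cvgr_gt _ (f_cvgR (udir x)) _ xh.
    by exists m.
  by move=> [m _ [x0 xf]]; split => //; exact: lt_le_trans xf _.
apply: nondecreasing_cvg_mu.
- by move=> m; exact: measurable_star_region.
- by apply: bigcupT_measurable => m; exact: measurable_star_region.
- move=> i j ij; apply/subsetPset => x [x0 xf]; split => //.
  by apply: lt_le_trans xf _; exact: f_nd.
Qed.

End polar.

(** * Elliptic polynomials with nonnegative coefficients *)

Section elliptic_polynomial.
Variables (R : realType) (n d : nat) (P : mpoly.mpoly n R).
Variables (d0 : (0 < d)%N) (P0 : nonneg_coeffs P).
Variables (Pdeg : has_degree d P) (Pell : elliptic P).
Local Notation T := (n.-tuple R).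
Local Notation Q := (top_part P).
Implicit Types (x y : T) (m : mpoly.multinom n).

Definition monomial_value x m : R := \prod_(i < n) tnth x i ^+ m i.

Lemma peval_monomials x :
  peval P x = \sum_(m <- mpoly.msupp P) mpoly.mcoeff m P * monomial_value x m.
Proof. exact: mpoly.mevalE. Qed.

Lemma peval_top_part x :
  peval Q x = \sum_(m <- mpoly.msupp P | mpoly.mdeg m == d)
                mpoly.mcoeff m P * monomial_value x m.
Proof.
rewrite /peval /top_part mpoly.pihomogE Pdeg /= raddf_sum /=.
by apply: eq_bigr => m _; rewrite mpoly.mevalZ mpoly.mevalX.
Qed.

Lemma monomial_value_ge0 x m : orthant x -> 0 <= monomial_value x m.
Proof. by move=> x0; apply: prodr_ge0 => i _; rewrite exprn_ge0. Qed.

Lemma ler_monomial_value x y m : (forall i, 0 <= tnth x i <= tnth y i) ->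
  monomial_value x m <= monomial_value y m.
Proof.
move=> xy; apply: ler_prod => i _; have /andP[x0 le_xy] := xy i.
by rewrite exprn_ge0// lerXn2r// nnegrE// (le_trans x0).
Qed.

Lemma monomial_value_dilate r x m :
  monomial_value (dilate r x) m = r ^+ mpoly.mdeg m * monomial_value x m.
Proof.
rewrite /monomial_value mpoly.mdegE -prodrXr -big_split /=.
by apply: eq_bigr => i _; rewrite tnth_dilate exprMn.
Qed.

Lemma monomial_value_box x m (L : R) : box L x -> monomial_value x m <= L ^+ mpoly.mdeg m.
Proof.
move=> xL; rewrite mpoly.mdegE -prodrXr; apply: ler_prod => i _.
have /andP[x0 xiL] := xL i.
by rewrite exprn_ge0// lerXn2r// nnegrE// (le_trans x0).
Qed.

Lemma peval_top_dilate r x : peval Q (dilate r x) = r ^+ d * peval Q x.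
Proof.
rewrite !peval_top_part mulr_sumr; apply: eq_bigr => m /eqP md.
by rewrite monomial_value_dilate md mulrCA.
Qed.

Lemma ler_peval_top x y : (forall i, 0 <= tnth x i <= tnth y i) ->
  peval Q x <= peval Q y.
Proof.
move=> xy; rewrite !peval_top_part; apply: ler_sum => m _.
by rewrite ler_wpM2l//; exact: ler_monomial_value.
Qed.

Lemma peval_ge0 x : orthant x -> 0 <= peval P x.
Proof.
move=> x0; rewrite peval_monomials; apply: sumr_ge0 => m _.
by rewrite mulr_ge0//; exact: monomial_value_ge0.
Qed.

Lemma peval_top_le x : orthant x -> peval Q x <= peval P x.
Proof.
move=> x0; rewrite peval_top_part peval_monomials [leRHS](bigID (fun m => mpoly.mdeg m == d))/=.
by rewrite lerDl sumr_ge0// => m _; rewrite mulr_ge0//; exact: monomial_value_ge0.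
Qed.

(** The monomials of degree less than d are at most L ^ (d - 1) on the box, and
    those of degree d have the same coefficients in P and Q. *)
Lemma peval_lower_order : exists2 K : R, 0 <= K &
  forall (L : R) x, 1 <= L -> box L x -> peval P x <= peval Q x + K * L ^+ d.-1.
Proof.
exists (\sum_(m <- mpoly.msupp P) mpoly.mcoeff m P); first by rewrite sumr_ge0.
move=> L x L1 xL.
rewrite peval_top_part peval_monomials [leLHS](bigID (fun m => mpoly.mdeg m == d))/=.
rewrite lerD2l big_mkcond mulr_suml /= big_seq [leRHS]big_seq.
apply: ler_sum => m mP; case: ifPn => [md|_]; last first.
  by rewrite mulr_ge0// exprn_ge0// (le_trans ler01).
rewrite ler_wpM2l//; apply: le_trans (monomial_value_box m xL) _.
apply: ler_weXn2l => //; have := mpoly.msize_mdeg_lt mP.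
by rewrite Pdeg ltnS leq_eqVlt (negbTE md)/= -[in (_ < d)%N](prednK d0) ltnS.
Qed.

Definition axis_point (i : 'I_n) : T := [tuple (j == i)%:R | j < n].

Lemma peval_top_axis_gt0 i : 0 < peval Q (axis_point i).
Proof.
apply: Pell => [j|/(congr1 (fun x => tnth x i))]; first by rewrite tnth_mktuple ler0n.
by rewrite tnth_mktuple eqxx tnth_nseq => /eqP; rewrite oner_eq0.
Qed.

(** Q increases in each coordinate, so setting the others to 0 lowers it. *)
Lemma peval_top_axis x i : orthant x ->
  tnth x i ^+ d * peval Q (axis_point i) <= peval Q x.
Proof.
move=> x0; rewrite -peval_top_dilate; apply: ler_peval_top => j.
rewrite tnth_dilate tnth_mktuple; case: eqP => [->|_]; last by rewrite mulr0 lexx x0.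
by rewrite mulr1 lexx x0.
Qed.

(** Nonnegative coefficients spare a compactness argument: the finitely many
    values Q(e_i) > 0 already bound the sublevel sets. *)
Lemma peval_top_bounded : exists2 L : R, 1 <= L &
  forall (s : R) x, 0 <= s -> orthant x -> peval Q x <= s ^+ d -> box (L * s) x.
Proof.
pose L : R := 1 + \sum_(i < n) (peval Q (axis_point i))^-1.
have q0 i : 0 <= (peval Q (axis_point i))^-1 by rewrite invr_ge0 ltW// peval_top_axis_gt0.
have L1 : 1 <= L by rewrite lerDl sumr_ge0.
exists L => // s x s0 x0 Qx i; rewrite x0/=.
have qi := peval_top_axis_gt0 i.
(* L >= 1 lets L absorb the d-th root. *)
have qL : (peval Q (axis_point i))^-1 <= L ^+ d.
  apply: (@le_trans _ _ L); last by rewrite -[leLHS]expr1; exact: ler_weXn2l.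
  by rewrite /L (bigD1 i)//= addrCA lerDl addr_ge0// sumr_ge0.
have Ls0 : 0 <= L * s by rewrite mulr_ge0// (le_trans ler01).
rewrite -(@ler_pXn2r _ d) ?nnegrE//.
apply: (@le_trans _ _ ((peval Q (axis_point i))^-1 * s ^+ d)).
  rewrite ler_pdivlMl// mulrC; apply: le_trans Qx; exact: peval_top_axis.
by rewrite exprMn ler_wpM2r// exprn_ge0.
Qed.

Lemma measurable_peval_top : measurable_fun setT (peval Q).
Proof.
rewrite (_ : peval Q = fun x => \sum_(m <- [seq m <- mpoly.msupp P | mpoly.mdeg m == d])
    mpoly.mcoeff m P * monomial_value x m); last first.
  by apply/funext => x; rewrite peval_top_part big_filter.
apply: measurable_sum => m; apply: measurable_funM => //.
by apply: measurable_prod => i _; apply: measurable_funX; exact: measurable_tnth.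
Qed.

Lemma measurable_orthant : measurable (@orthant R n).
Proof.
rewrite (_ : orthant = \bigcap_(i in [set: 'I_n]) ((fun x => tnth x i) @^-1` `[0, +oo[%classic)).
  apply: fin_bigcap_measurable => // i _; rewrite -[X in measurable X]setTI.
  exact: measurable_tnth.
by apply/seteqP; split => x x0 i; have := x0 i; rewrite /= in_itv/= andbT => h; auto.
Qed.

Definition sublevel (s : R) : set T := [set x | orthant x /\ peval Q x < s ^+ d].

Lemma measurable_sublevel s : measurable (sublevel s).
Proof.
rewrite (_ : sublevel s = orthant `&` (peval Q @^-1` `]-oo, s ^+ d[%classic)).
  apply: measurableI; first exact: measurable_orthant.
  by rewrite -[X in measurable X]setTI; exact: measurable_peval_top.
by apply/seteqP; split => x /=; rewrite in_itv.
Qed.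

Lemma sublevel_down_set s : down_set (sublevel s).
Proof.
move=> x y [x0 Qx] yx; split; first by move=> i; have /andP[] := yx i.
by apply: le_lt_trans Qx; exact: ler_peval_top.
Qed.

(** The sublevel set of level s is the dilate by s of that of level 1. *)
Lemma lebesgue_sublevel s : 0 < s ->
  lebesgue_tuple n (sublevel s) = ((s ^+ n)%:E * lebesgue_tuple n (sublevel 1))%E.
Proof.
move=> s0; have si : 0 < s^-1 by rewrite invr_gt0.
rewrite -[s in RHS]invrK -lebesgue_tuple_dilate//; last exact: measurable_sublevel.
congr (lebesgue_tuple n _); apply/seteqP.
have E x : (peval Q (dilate s^-1 x) < 1 ^+ d) = (peval Q x < s ^+ d).
  by rewrite peval_top_dilate expr1n exprVn ltr_pdivrMl ?exprn_gt0// mulr1.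
split => x [x0 Qx]; split; rewrite -?E// ?E// => i.
  by rewrite tnth_dilate mulr_ge0// ltW.
by have := x0 i; rewrite tnth_dilate pmulr_rge0.
Qed.

End elliptic_polynomial.

(** * The leading constant as a volume *)

Section volume.
Variables (R : realType) (n d : nat) (P : mpoly.mpoly n R).
Variables (n0 : (0 < n)%N) (d0 : (0 < d)%N) (P0 : nonneg_coeffs P).
Variables (Pdeg : has_degree d P) (Pell : elliptic P).
Local Notation T := (n.-tuple R).
Local Notation Q := (top_part P).
Implicit Types (x : T).

Let origin : T := [tuple of nseq n 0].

Lemma enorm_eq0 x : enorm x = 0 -> x = origin.
Proof.
move/eqP; rewrite sqrtr_eq0 => x0; apply: eq_from_tnth => i; rewrite tnth_nseq.
have : \sum_(j < n) tnth x j ^+ 2 == 0.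
  by rewrite eq_le x0 sumr_ge0// => j _; exact: sqr_ge0.
rewrite psumr_eq0 => [/allP/(_ i)|j _]; last exact: sqr_ge0.
by rewrite mem_index_enum sqrf_eq0 => /(_ isT)/eqP.
Qed.

Lemma enorm_gt0 x : x <> origin -> 0 < enorm x.
Proof.
by move=> xN0; rewrite lt_def enorm_ge0 andbT; apply/eqP => /enorm_eq0.
Qed.

Lemma udirE x : udir x = dilate (enorm x)^-1 x.
Proof. by apply: eq_from_tnth => i; rewrite !tnth_mktuple. Qed.

Lemma enorm_udir x : 0 < enorm x -> enorm (udir x) = 1.
Proof. by move=> x0; rewrite udirE enorm_dilate ?invr_gt0// mulVf// gt_eqF. Qed.

Lemma measurable_origin : measurable [set origin].
Proof.
rewrite (_ : [set origin] = @enorm R n @^-1` [set 0]).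
  by apply: measurable_enorm_preimage; exact: measurable_set1.
apply/seteqP; split => [x -> /=|x /enorm_eq0 //].
by rewrite /enorm big1 ?sqrtr0// => i _; rewrite tnth_nseq expr0n.
Qed.

(** The origin is invariant under the dilation by 2, which multiplies volumes by
    2 ^ n > 1. *)
Lemma lebesgue_origin : lebesgue_tuple n [set origin] = 0%E.
Proof.
have o1 : [set origin] `<=` box 1.
  by move=> x -> i; rewrite tnth_nseq lexx ler01.
have fo := lebesgue_tuple_fin (lexx 1) measurable_origin o1.
have := lebesgue_tuple_dilate (ltr0n R 2) measurable_origin.
have -> : dilate 2 @^-1` [set origin] = [set origin].
  apply/seteqP; split => x /= => [/(congr1 (fun y => tnth y))|->].
    move=> E; apply: eq_from_tnth => i; have := congr1 (@^~ i) E.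
    rewrite /= tnth_dilate !tnth_nseq => /eqP.
    by rewrite mulf_eq0 pnatr_eq0/= => /eqP.
  by apply: eq_from_tnth => i; rewrite tnth_dilate !tnth_nseq mulr0.
rewrite -(fineK fo) -EFinM => -[E]; congr (_%:E).
have r1 : 2^-1 ^+ n < 1 :> R by rewrite exprn_ilt1 ?invr_ge0// -?lt0n// invf_lt1 ?ltr1n.
apply/eqP/negPn/negP => f0.
by have := congr1 (fun u => u / fine (lebesgue_tuple n [set origin])) E;
  rewrite mulfK// mulfV// => r1'; move: r1; rewrite -r1' ltxx.
Qed.

(** The integrand of the leading constant, extended by 0 to all of the space;
    vanishing off the orthant keeps its star region inside the orthant. *)
Definition star_density (v : T) : R :=
  ((fun v => peval Q v `^ (- (n%:R / d%:R))) \_ (sphere `&` orthant)) v.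

Lemma measurable_sphere_orthant : measurable (@sphere R n `&` orthant).
Proof.
apply: measurableI; last exact: measurable_orthant.
by apply: (@measurable_enorm_preimage R n [set 1]); exact: measurable_set1.
Qed.

Lemma measurable_star_density : measurable_fun setT star_density.
Proof.
apply/(measurable_restrict _ measurable_sphere_orthant) => //.
rewrite setTI; apply: measurable_funTS.
apply: (measurableT_comp (measurable_powR _)).
exact: (measurable_peval_top Pdeg).
Qed.

Lemma star_density_ge0 v : 0 <= star_density v.
Proof. by rewrite /star_density patchE; case: ifP => // _; exact: powR_ge0. Qed.

(** For x = |x| u in the orthant, |x| ^ n < Q(u) ^ (- n / d) amounts to
    Q(x) = |x| ^ d Q(u) < 1. *)
Lemma star_region_sublevel : star_region star_density = sublevel d P 1 `\` [set origin].
Proof.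
have key x : 0 < enorm x -> orthant x -> (enorm x ^+ n < star_density (udir x)) = (peval Q x < 1).
  move=> x0 ox; have ou : orthant (udir x).
    by move=> i; rewrite udirE tnth_dilate mulr_ge0// invr_ge0 ltW.
  rewrite /star_density patchE mem_set; last by split => //; exact: enorm_udir.
  have qx : peval Q x = enorm x ^+ d * peval Q (udir x).
    by rewrite udirE (peval_top_dilate Pdeg) mulrA -exprMn mulfV ?gt_eqF// expr1n mul1r.
  have q0 : 0 < peval Q (udir x).
    apply: Pell => // E; have := enorm_udir x0; rewrite E /enorm big1 ?sqrtr0.
      by move/eqP; rewrite eq_sym oner_eq0.
    by move=> i _; rewrite tnth_nseq expr0n.
  rewrite qx; set q := peval Q (udir x) in q0 *.
  pose b := q^-1 `^ d%:R^-1.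
  have b0 : 0 < b by rewrite powR_gt0// invr_gt0.
  have bd : b ^+ d = q^-1.
    rewrite -powR_mulrn ?powR_ge0// -powRrM mulVf ?pnatr_eq0 ?gtn_eqF//.
    by rewrite powRr1// invr_ge0 ltW.
  have -> : q `^ (- (n%:R / d%:R)) = b ^+ n.
    rewrite -powR_mulrn ?powR_ge0// /b -powRrM -(powR_inv1 (ltW q0)) -powRrM.
    by congr (_ `^ _); rewrite mulN1r mulrC.
  rewrite ltr_pXn2r ?nnegrE ?enorm_ge0 ?(ltW b0)//.
  by rewrite -(@ltr_pXn2r _ d) ?nnegrE ?enorm_ge0 ?(ltW b0)// bd -ltr_pdivlMr// div1r.
apply/seteqP; split => x.
  move=> [x0 xs]; have ox : orthant x.
    move: xs; rewrite /star_density patchE; case: ifPn => [/set_mem[_ ou] _ i|_]; last first.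
      by rewrite ltNge exprn_ge0// ltW.
    by have := ou i; rewrite udirE tnth_dilate pmulr_rge0// invr_gt0.
  split; first by split => //; rewrite expr1n -key.
  by move=> xo; move: x0; rewrite xo /enorm big1 ?sqrtr0 ?ltxx// => i _; rewrite tnth_nseq expr0n.
move=> [[ox Qx] /enorm_gt0 x0]; split => //.
by rewrite key// -(expr1n _ d).
Qed.

Lemma lebesgue_sublevel_fin : lebesgue_tuple n (sublevel d P 1) \is a fin_num.
Proof.
have [L L1 bd] := peval_top_bounded d0 P0 Pdeg Pell.
apply: (lebesgue_tuple_fin L1); first exact: measurable_sublevel.
by move=> x [ox Qx]; have := bd 1 x ler01 ox (ltW Qx); rewrite mulr1.
Qed.

Lemma lebesgue_star_region :
  lebesgue_tuple n (star_region star_density) = lebesgue_tuple n (sublevel d P 1).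
Proof.
have mS := measurable_sublevel Pdeg 1.
pose mu : {measure set T -> \bar R} := lebesgue_tuple n.
have -> : lebesgue_tuple n (sublevel d P 1) =
    (mu (sublevel d P 1 `\` [set origin]) + mu (sublevel d P 1 `&` [set origin]))%E.
  by rewrite -measureDI//; exact: measurable_origin.
rewrite star_region_sublevel (_ : mu (sublevel d P 1 `&` _) = 0%E) ?adde0//.
apply/eqP; rewrite eq_le; apply/andP; split; last exact: measure_ge0.
rewrite -lebesgue_origin.
apply: (le_measure mu); rewrite ?inE//; last exact: measurable_origin.
by apply: measurableI => //; exact: measurable_origin.
Qed.

Lemma leading_constant_volume k :
  leading_constant k d P = density k ^+ n * fine (lebesgue_tuple n (sublevel d P 1)).
Proof.
rewrite /leading_constant /Rintegral; congr (_ * _).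
rewrite integral_mkcond.
transitivity (n%:R^-1 * fine (\int[@surface_measure R n]_v (star_density v)%:E)).
  congr (_ * fine _); apply: eq_integral => v _.
  by rewrite /star_density !patchE; case: ifP.
rewrite surface_integral_star_region//.
- rewrite lebesgue_star_region -(fineK lebesgue_sublevel_fin) -EFinM /= mulrA mulVf ?mul1r//.
  by rewrite pnatr_eq0 gtn_eqF.
- exact: measurable_star_density.
- exact: star_density_ge0.
Qed.

End volume.

(** * From the leading form to the polynomial *)

Lemma exprn_diff_le (R : realFieldType) (n : nat) (a b : R) : 0 <= a -> a <= b ->
  b ^+ n - a ^+ n <= n%:R * (b - a) * b ^+ n.-1.
Proof.
move=> a0 ab; have b0 : 0 <= b := le_trans a0 ab.
rewrite subrXX -mulrA [leRHS]mulrCA ler_wpM2l ?subr_ge0//.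
rewrite mulr_natl -[in leRHS](card_ord n) -sumr_const; apply: ler_sum => i _.
have ni : (i <= n.-1)%N by rewrite -ltnS prednK// (leq_ltn_trans _ (ltn_ord i)).
rewrite card_ord -[in leRHS](subnK ni) exprD.
by rewrite ler_wpM2l ?exprn_ge0// lerXn2r.
Qed.

Section sandwich.
Variables (R : realType) (n k d : nat) (P : mpoly.mpoly n R) (c : R).
Variables (n0 : (0 < n)%N) (k2 : (2 <= k)%N) (d0 : (0 < d)%N) (P0 : nonneg_coeffs P).
Variables (Pdeg : has_degree d P) (Pell : elliptic P).
Variable cE : c = density k ^+ n * fine (lebesgue_tuple n (sublevel d P 1)).
Local Notation T := (n.-tuple R).
Local Notation Q := (top_part P).

Lemma natr_tuple_orthant (u : n.-tuple nat) : orthant (@natr_tuple R n u).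
Proof. by move=> i; rewrite tnth_map ler0n. Qed.

Lemma powR_root_le (a t : R) : 0 <= a -> 0 <= t -> (a `^ d%:R^-1 <= t) = (a <= t ^+ d).
Proof.
move=> a0 t0.
have {2}<- : (a `^ d%:R^-1) ^+ d = a.
  by rewrite -powR_mulrn ?powR_ge0// -powRrM mulVf ?pnatr_eq0 ?gtn_eqF// powRr1.
by rewrite ler_pXn2r// nnegrE powR_ge0.
Qed.

(** The grid is adapted to a level M >= s, so that two sublevel sets can be
    counted on the same grid. *)
Lemma sublevel_count (L M s : R) : 1 <= L * M -> 0 < s -> s <= M -> 0 <= L ->
  (forall (s : R) (x : T), 0 <= s -> orthant x -> peval Q x <= s ^+ d -> box (L * s) x) ->
  `|(grid_count k (Num.truncn (L * M)) (sublevel d P s))%:R - c * s ^+ n|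
    <= 23 * n%:R * ((L * M) `^ saving * (L * M) ^+ n.-1).
Proof.
move=> LM1 s0 sM L0 bd; have mS := measurable_sublevel Pdeg s.
have -> : c * s ^+ n = density k ^+ n * fine (lebesgue_tuple n (sublevel d P s)).
  rewrite (lebesgue_sublevel Pdeg s0) -(fineK (lebesgue_sublevel_fin d0 P0 Pdeg Pell)).
  by rewrite -EFinM /= cE mulrAC mulrA.
apply: grid_count_estimate => //; last exact: sublevel_down_set.
move=> x [ox Qx] i; have /andP[-> /le_trans -> //] := bd s x (ltW s0) ox (ltW Qx) i.
by rewrite ler_wpM2l.
Qed.

(** The points counted lie between the sublevel sets of Q of levels t - K' and
    t + 1.  The level t + 1 turns the non-strict inequality P <= t ^ d into the
    strict one defining sublevel sets; the level t - K' makes up for the lower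
    order terms, as (t - K') ^ d + K' t ^ (d - 1) <= t ^ d. *)
Lemma count_kfree_estimate : exists M : R, forall t, 1 <= t -> M <= t ->
  `|(count_kfree k d P t)%:R - c * t ^+ n| <= M * (t `^ saving * t ^+ n.-1).
Proof.
have [L L1 bd] := peval_top_bounded d0 P0 Pdeg Pell.
have [K K0 low] := peval_lower_order d0 P0 Pdeg.
have L0 : 0 <= L := le_trans ler01 L1.
have c0 : 0 <= c.
  rewrite cE; apply: mulr_ge0; first by rewrite exprn_ge0// ltW// density_gt0.
  by apply: fine_ge0; exact: leb_ge0.
pose K' := K * L ^+ d.-1.
have K'0 : 0 <= K' by rewrite mulr_ge0// exprn_ge0.
pose A := 23 * n%:R * ((L * 2) `^ saving * (L * 2) ^+ n.-1).
pose B := c * (n%:R * (1 + K') * 2 ^+ n.-1).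
have A0 : 0 <= A by rewrite !mulr_ge0// ?powR_ge0 ?exprn_ge0 ?mulr_ge0.
have B0 : 0 <= B.
  apply: mulr_ge0 => //; apply: mulr_ge0; last exact: exprn_ge0.
  by apply: mulr_ge0; rewrite ?ler0n// addr_ge0.
(* The summand K' + 1 only ensures that t exceeds K'. *)
exists (A + B + K' + 1) => t t1 Mt.
have t0 : 0 <= t := le_trans ler01 t1.
have tK : K' < t by lra.
have s0 : 0 < t - K' by rewrite subr_gt0.
have LM1 : 1 <= L * (t + 1) by rewrite -[leLHS]mul1r ler_pM//; lra.
set N := Num.truncn (L * (t + 1)).
pose D : set T := [set x | peval P x `^ d%:R^-1 <= t].
have DN (u : n.-tuple nat) : D (natr_tuple R u) ->
    sublevel d P (t + 1) (natr_tuple R u).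
  have ou := natr_tuple_orthant u.
  move=> Du; split => //; move: Du; rewrite /D /= powR_root_le ?peval_ge0// => Pu.
  apply: le_lt_trans (peval_top_le P0 Pdeg ou) _; apply: le_lt_trans Pu _.
  by rewrite ltr_pXn2r ?nnegrE ?ltrDl// addr_ge0.
have -> : count_kfree k d P t = grid_count k N D.
  apply: card_kfree_points => u /DN[ou Qu] i.
  have t10 : 0 <= t + 1 by rewrite addr_ge0.
  have /andP[_] := bd _ _ t10 ou (ltW Qu) i.
  by rewrite tnth_map truncn_ge_nat// mulr_ge0.
have up : (grid_count k N D <= grid_count k N (sublevel d P (t + 1)))%N.
  by apply: grid_count_le => u _; exact: DN.
have lo : (grid_count k N (sublevel d P (t - K')) <= grid_count k N D)%N.
  apply: grid_count_le => u _ [ou Qu]; rewrite /D /= powR_root_le ?peval_ge0//.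
  have bx : box (L * t) (natr_tuple R u).
    move=> i; have /andP[-> /le_trans -> //] := bd _ _ (ltW s0) ou (ltW Qu) i.
    by rewrite ler_wpM2l// gerBl.
  have Lt1 : 1 <= L * t by rewrite -[leLHS]mul1r ler_pM.
  apply: le_trans (low _ _ Lt1 bx) _.
  rewrite exprMn mulrA -/K'.
  apply: (@le_trans _ _ ((t - K') * t ^+ d.-1 + K' * t ^+ d.-1)).
    rewrite lerD2r; apply: le_trans (ltW Qu) _.
    rewrite -[in X in _ ^+ X](prednK d0) exprS ler_wpM2l ?(ltW s0)// lerXn2r ?nnegrE ?(ltW s0)//.
    by rewrite gerBl.
  by rewrite -mulrDl subrK -exprS (prednK d0).
have est (s : R) : 0 < s -> s <= t + 1 ->
    `|(grid_count k N (sublevel d P s))%:R - c * s ^+ n| <= A * (t `^ saving * t ^+ n.-1).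
  move=> s0' st; apply: le_trans (sublevel_count LM1 s0' st L0 bd) _.
  have t2 : L * (t + 1) <= (L * 2) * t by rewrite -mulrA ler_wpM2l//; lra.
  have LM0 : 0 <= L * (t + 1) := le_trans ler01 LM1.
  rewrite /A -!mulrA ler_wpM2l// ler_wpM2l//.
  apply: (@le_trans _ _ (((L * 2) * t) `^ saving * ((L * 2) * t) ^+ n.-1)).
    rewrite ler_pM ?powR_ge0 ?exprn_ge0//.
      by apply: ge0_ler_powR; rewrite ?nnegrE ?mulr_ge0// /saving; lra.
    by apply: lerXn2r; rewrite ?nnegrE// !mulr_ge0.
  rewrite powRM ?mulr_ge0// exprMn.
  by rewrite le_eqVlt; apply/orP; left; apply/eqP; ring.
have tn : t ^+ n.-1 <= t `^ saving * t ^+ n.-1.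
  rewrite ler_peMl ?exprn_ge0// -(powRr0 t) ler_powR// /saving; lra.
have pow2 : (t + 1) ^+ n.-1 <= 2 ^+ n.-1 * t ^+ n.-1.
  by rewrite -exprMn lerXn2r ?nnegrE ?mulr_ge0 ?addr_ge0//; lra.
have B1 : c * (t + 1) ^+ n - c * t ^+ n <= B * (t `^ saving * t ^+ n.-1).
  rewrite -mulrBr /B -!mulrA ler_wpM2l//.
  apply: le_trans (exprn_diff_le n t0 (_ : t <= t + 1)) _; first by rewrite lerDl.
  rewrite addrAC subrr add0r mulr1 ler_wpM2l//.
  apply: le_trans pow2 _; apply: (@le_trans _ _ (2 ^+ n.-1 * (t `^ saving * t ^+ n.-1))).
    by rewrite ler_wpM2l// exprn_ge0//.
  by rewrite ler_peMl ?lerDl// !mulr_ge0 ?exprn_ge0// powR_ge0.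
have B2 : c * t ^+ n - c * (t - K') ^+ n <= B * (t `^ saving * t ^+ n.-1).
  rewrite -mulrBr /B -!mulrA ler_wpM2l//.
  apply: le_trans (exprn_diff_le n (ltW s0) (_ : t - K' <= t)) _; first by rewrite gerBl.
  rewrite opprB addrC subrK -mulrA ler_wpM2l//.
  apply: ler_pM; rewrite ?exprn_ge0//; first by rewrite lerDr.
  apply: le_trans tn _; rewrite ler_peMl ?mulr_ge0 ?powR_ge0 ?exprn_ge0//.
  by rewrite exprn_ege1// ler1n.
have t10 : 0 < t + 1 by lra.
have tK1 : t - K' <= t + 1 by lra.
have := est _ t10 (lexx _); have := est _ s0 tK1.
move: up lo; rewrite -!(ler_nat R).
set g := (grid_count k N D)%:R => up lo; rewrite !ler_norml.
have W0 : 0 <= t `^ saving * t ^+ n.-1 by rewrite mulr_ge0 ?powR_ge0 ?exprn_ge0.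
set W := t `^ saving * _ in W0 B1 B2 *.
move=> /andP[lo1 _] /andP[_ up1].
have X0 : 0 <= (K' + 1) * W by rewrite mulr_ge0// addr_ge0.
have -> : (A + B + K' + 1) * W = A * W + B * W + (K' + 1) * W by ring.
by apply/andP; split; lra.
Qed.

End sandwich.

Theorem corollary3 (R : realType) (n k d : nat) (P : mpoly.mpoly n R)
    (hn : (1 <= n)%N) (hk : (2 <= k)%N) (hd : (1 <= d)%N)
    (hP : nonneg_coeffs P) (hdeg : has_degree d P) (hell : elliptic P) :
  exists2 theta : R, 0 < theta &
    exists M : R, \forall t \near +oo,
      `|(count_kfree k d P t)%:R - leading_constant k d P * t ^+ n|
        <= M * t `^ (n%:R - theta).
Proof.
exists (1 - saving); first by rewrite /saving; lra.
have [M est] := count_kfree_estimate hk hd hP hdeg hell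
  (leading_constant_volume hn hd hP hdeg hell k).
exists M; near=> t.
have t1 : 1 <= t by near: t; exact: nbhs_pinfty_ge.
have t0 : 0 < t := lt_le_trans ltr01 t1.
have -> : t `^ (n%:R - (1 - saving)) = t `^ saving * t ^+ n.-1.
  rewrite -powR_mulrn ?(ltW t0)// -powRD; last by rewrite (gt_eqF t0) implybT.
  by congr (_ `^ _); rewrite -[in LHS](prednK hn) -natr1; ring.
apply: est => //; near: t; exact: nbhs_pinfty_ge.
Unshelve. all: by end_near.
Qed.
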